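(* Let $F$ be a Sidorenko-good graph that is not a matching. Then: (i) if a bounded doubly nonnegative kernel $K$ with $\|K\|_1>0$ satisfies $t(F,K)=\|K\|_1^{e(F)}$, then $K$ is $\|K\|_1$-regular and $K-\|K\|_1\mathbf 1\succeq0$; (ii) $F$ is regular-KNRS; (iii) $F$ is Sidorenko-good-forcing if and only if $F$ is regular-KNRS-forcing.
   Context: All underlying probability spaces $(\Omega,\mu)$ are standard and atomless (so isomorphic to $[0,1]$ with Lebesgue measure $\lambda$). Graphs are finite and simple, with at least one edge; isolated vertices are deleted; $e(F)$ is the number of edges, and a matching is a graph $mK_2$ (after deletion of isolated vertices). For a bounded symmetric measurable $K:\Omega^2\to\mathbb R$, $K\succeq0$ means $\int f(x)K(x,y)f(y)\,d\mu(x)\,d\mu(y)\ge0$ for every bounded measurable real-valued $f$ on $\Omega$. A bounded doubly nonnegative kernel is a bounded symmetric measurable $K:\Omega^2\to[0,\infty)$ with $K\succeq0$. Write $\|K\|_1=\int_{\Omega^2}K\,d\mu\,d\mu$ and $t(F,K)=\int_{\Omega^{V(F)}}\prod_{uv\in E(F)}K(x_u,x_v)\prod_{u\in V(F)}d\mu(x_u)$. $\mathbf 1$ is the constant function $1$. $K$ is $p$-regular if $\int_\Omega K(x,y)\,d\mu(y)=p$ for almost every $x$. A graphon is a symmetric measurable function with values in $[0,1]$. $F$ is Sidorenko-good if $t(F,K)\ge\|K\|_1^{e(F)}$ for every bounded doubly nonnegative kernel $K$. A Sidorenko-good graph $F$ is Sidorenko-good-forcing if, for every bounded doubly nonnegative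 kernel $K$ with $\|K\|_1\in(0,\infty)$, the equality $t(F,K)=\|K\|_1^{e(F)}$ implies $K=\|K\|_1\mathbf 1$ almost everywhere. For $\rho_0\in[0,1]$, a graphon $W:[0,1]^2\to[0,1]$ is $\rho_0$-locally dense if $\int_{S\times S}W(x,y)\,dx\,dy\ge\rho_0\lambda(S)^2$ for every measurable $S\subseteq[0,1]$. It is $\rho_0$-regular if $\int_0^1W(x,y)\,dy=\rho_0$ for almost every $x$. $F$ is regular-KNRS if, for every $\rho_0\in[0,1]$ and every $\rho_0$-locally dense, $\rho_0$-regular graphon $W$, $t(F,W)\ge\rho_0^{e(F)}$. A regular-KNRS graph $F$ is regular-KNRS-forcing if, for every $0<\rho_0<1$ and every $\rho_0$-locally dense, $\rho_0$-regular graphon $W$, the equality $t(F,W)=\rho_0^{e(F)}$ implies $W=\rho_0\mathbf 1$ almost everywhere. *)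

(* Defs.v *)
From HB Require Import structures.
From mathcomp Require Import all_boot all_order all_algebra.
From mathcomp Require Import all_classical all_reals all_analysis.

Set Implicit Arguments.
Unset Strict Implicit.
Unset Printing Implicit Defensive.

Import Order.TTheory GRing.Theory Num.Theory.
Import numFieldNormedType.Exports.
Local Open Scope classical_set_scope.
Local Open Scope ring_scope.

Record sgraph := SGraph {
  svertex :> finType;
  sedge : rel svertex;
  sedge_sym : symmetric sedge;
  sedge_irrefl : irreflexive sedge;
  sedge_nonisolated : forall u, exists v, sedge u v;
  sedge_nonempty : exists u v, sedge u v
}.

(* Each edge uv is listed once, as the ordered pair in which u comes first in
   the enumeration of the vertices. *)
Definition edges (F : sgraph) : {set F * F} :=
  [set e | sedge e.1 e.2 && (enum_rank e.1 < enum_rank e.2)%N].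

Definition edge_count (F : sgraph) : nat := #|edges F|.

(* In mK_2, the vertices (i, false) and (i, true) are the ends of edge i. *)
Definition mK2_edge (m : nat) : rel ('I_m * bool) :=
  fun a b => (a.1 == b.1) && (a.2 != b.2).

Definition is_matching (F : sgraph) : Prop :=
  exists m (h : F -> 'I_m * bool),
    bijective h /\ forall u v, sedge u v = mK2_edge (h u) (h v).

Section probability_spaces.
Context {R : realType}.

Definition iso_mod0 d1 d2 (T1 : measurableType d1) (T2 : measurableType d2)
    (P : probability T1 R) (Q : probability T2 R) : Prop :=
  exists (X : set T1) (Y : set T2) (f : T1 -> T2) (g : T2 -> T1),
    [/\ measurable X, measurable Y, P X = 1%E & Q Y = 1%E] /\
    [/\ {homo f : x / X x >-> Y x}, {homo g : y / Y y >-> X y},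
        (forall x, X x -> g (f x) = x) & (forall y, Y y -> f (g y) = y)] /\
    [/\ measurable_fun X f, measurable_fun Y g &
        forall B, measurable B -> B `<=` Y -> P (X `&` f @^-1` B) = Q B].

(* Rokhlin's notion: up to null sets, the space is the real line with some
   Borel probability measure (possibly with atoms). *)
Definition standard d (T : measurableType d) (P : probability T R) : Prop :=
  exists Q : probability (measurableTypeR R) R, iso_mod0 P Q.

Definition atomless d (T : measurableType d) (P : probability T R) : Prop :=
  forall A, measurable A -> (0 < P A)%E ->
    exists B, [/\ measurable B, B `<=` A, (0 < P B)%E & (P B < P A)%E].

(* The unit interval is represented by the line with Lebesgue measure
   restricted to [0,1]; a function on [0,1] (or on its square) by any
   measurable extension, for instance the one by 0. *)
Definition lambda01 : set (measurableTypeR R) -> \bar R :=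
  mrestr lebesgue_measure (measurable_itv `[0%R, 1%R]).

HB.instance Definition _ := Measure.on lambda01.

Let lambda01_setT : lambda01 [set: _] = 1%E.
Proof.
by rewrite /lambda01 /mrestr setTI lebesgue_measure_itv/= lte_fin ltr01 sube0.
Qed.

HB.instance Definition _ :=
  Measure_isProbability.Build _ _ _ lambda01 lambda01_setT.

End probability_spaces.
Arguments lambda01 R : clear implicits.

Section product_power.
Context {R : realType} d (T : measurableType d) (P : probability T R).

Definition cons_pair n (z : T * n.-tuple T) : n.+1.-tuple T :=
  [tuple of z.1 :: z.2].

Lemma measurable_cons_pair n : measurable_fun [set: _] (@cons_pair n).
Proof. exact: measurable_cons measurable_fst measurable_snd. Qed.

HB.instance Definition _ n :=
  isMeasurableFun.Build _ _ _ _ (@cons_pair n) (@measurable_cons_pair n).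

(* The n-fold product of P with itself, on T^n with the sigma-algebra
   generated by the coordinates. *)
Fixpoint power_prob (n : nat) : probability (n.-tuple T) R :=
  match n with
  | 0 => \d_([tuple] : 0.-tuple T)
  | m.+1 => distribution (P \x power_prob m)%E (@cons_pair m)
  end.

End product_power.

Section kernels.
Context {R : realType} d (T : measurableType d) (P : probability T R).
Implicit Types (K W : T -> T -> R) (f : T -> R).

Definition kernel_measurable K : Prop :=
  measurable_fun [set: T * T] (fun z => K z.1 z.2).

Definition kernel_symmetric K : Prop := forall x y, K x y = K y x.

Definition kernel_bounded K : Prop := exists M : R, forall x y, `|K x y| <= M.

Definition kernel_psd K : Prop :=
  forall f, measurable_fun [set: T] f -> (exists M : R, forall x, `|f x| <= M) ->
    0 <= \int[(P \x P)%E]_z (f z.1 * K z.1 z.2 * f z.2).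

Definition bounded_dnn K : Prop :=
  [/\ kernel_measurable K, kernel_symmetric K, kernel_bounded K,
      (forall x y, 0 <= K x y) & kernel_psd K].

(* The L^1 norm; only used for nonnegative kernels. *)
Definition norm1 K : R := \int[(P \x P)%E]_z K z.1 z.2.

Definition hom_density (F : sgraph) K : R :=
  \int[power_prob P #|F|]_x
    \prod_(e in edges F) K (tnth x (enum_rank e.1)) (tnth x (enum_rank e.2)).

Definition kernel_regular (p : R) K : Prop :=
  {ae P, forall x, \int[P]_y K x y = p}.

Definition ae_constant (p : R) K : Prop :=
  {ae (P \x P)%E, forall z, K z.1 z.2 = p}.

Definition graphon W : Prop :=
  [/\ kernel_measurable W, kernel_symmetric W & forall x y, 0 <= W x y <= 1].

Definition locally_dense (rho : R) W : Prop :=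
  forall S : set T, measurable S ->
    rho * fine (P S) ^+ 2 <= \int[(P \x P)%E]_(z in S `*` S) W z.1 z.2.

End kernels.

Section sidorenko_knrs.
Variable R : realType.

Definition sidorenko_good (F : sgraph) : Prop :=
  forall (d : measure_display) (T : measurableType d) (P : probability T R)
    (K : T -> T -> R),
  standard P -> atomless P -> bounded_dnn P K ->
  norm1 P K ^+ edge_count F <= hom_density P F K.

Definition sidorenko_good_forcing (F : sgraph) : Prop :=
  sidorenko_good F /\
  forall (d : measure_display) (T : measurableType d) (P : probability T R)
    (K : T -> T -> R),
  standard P -> atomless P -> bounded_dnn P K -> 0 < norm1 P K ->
  hom_density P F K = norm1 P K ^+ edge_count F ->
  ae_constant P (norm1 P K) K.

Definition regular_KNRS (F : sgraph) : Prop :=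
  forall (rho : R) (W : measurableTypeR R -> measurableTypeR R -> R),
  0 <= rho <= 1 -> graphon W ->
  locally_dense (lambda01 R) rho W -> kernel_regular (lambda01 R) rho W ->
  rho ^+ edge_count F <= hom_density (lambda01 R) F W.

Definition regular_KNRS_forcing (F : sgraph) : Prop :=
  regular_KNRS F /\
  forall (rho : R) (W : measurableTypeR R -> measurableTypeR R -> R),
  0 < rho < 1 -> graphon W ->
  locally_dense (lambda01 R) rho W -> kernel_regular (lambda01 R) rho W ->
  hom_density (lambda01 R) F W = rho ^+ edge_count F ->
  ae_constant (lambda01 R) rho W.

End sidorenko_knrs.

(* Main.v *)
Require Import Defs.
From HB Require Import structures.
From mathcomp Require Import all_boot all_order all_algebra.
From mathcomp Require Import all_classical all_reals all_analysis.
From mathcomp Require Import measurable_realfun ring lra.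

Set Implicit Arguments.
Unset Strict Implicit.
Unset Printing Implicit Defensive.

Import Order.TTheory GRing.Theory Num.Theory.
Import numFieldNormedType.Exports.
Local Open Scope classical_set_scope.
Local Open Scope ring_scope.

(** Write [e] for the number of edges of [F], [p] for the norm of [K], [t = p^e] for its
    density and, for a bounded measurable function [a], [D(a)] for the integral of
    [a(x) K(x,y)] and [T_u(a)] for the integral of [a(x_u)] times the product of [K]
    over the edges of [F].

    Part (i). In the equality case the good inequality can be perturbed in two ways: the
    kernel can be replaced by [f(x) K(x,y) f(y)], and the measure by one with a positive
    density [w]. With [f = 1 + s b] and [w = 1 + s a], where [a] has mean zero, the
    inequality is tight at [s = 0], so the derivatives of both sides agree
    ([first_order]):

      [p (sum over the ends u of edges of T_u(b) + sum over vertices of T_u(a))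
         = 2 e t (D(a) + D(b))].

    This alone does not force regularity. The decisive step is to apply it also to the
    tensor square of [K], which again attains equality, on the square of the space. At
    product functions its moments are the squares of those of [K]. Taking [a = 0], the
    numbers [p T_u(b)], averaged over the ends of edges, have mean [t D(b)] and mean
    square [(t D(b))^2], hence they are all equal to [t D(b)]. Taking the product
    function [a(x) a(y)] for the density and its negative for the scaling, the sum of
    [(deg u - 1) T_u(a)^2] over the vertices is zero whenever [a] has mean zero. A
    graph that is not a matching has a vertex of degree at least 2
    ([exists_degree_ge2]), so [D(a) = 0] for all [a] of mean zero. This says that [K] is
    [p]-regular; then [K - p] annihilates constants and inherits semidefiniteness
    from [K].

    That the tensor square is admissible takes the Schur product theorem for kernels
    ([psd_tensor]), which follows from the one for matrices because functions of finite
    rank are dense, and a measurable embedding of the plane into the line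
    ([standard_prod]).

    Part (ii). Local density says that the form of [W - rho] is nonnegative on
    indicators. Evaluating it at a random union of small cells gives the same for
    functions with values in [0,1] ([dense_bform_ge0_01]). Since [W - rho] annihilates
    constants, it is positive semidefinite ([dense_psd]), and so is [W]; the good
    inequality for [W] is the desired one.

    Part (iii). By (ii) a locally dense regular graphon is a doubly nonnegative kernel
    of norm [rho], which gives one implication. Conversely, a kernel attaining equality
    is regular with [K - p] positive semidefinite by (i). Transporting it to the unit
    interval by a quantile function ([lambda01_transport]) and scaling it into [0,1]
    yields a locally dense regular graphon that attains equality, hence is constant. *)

(** * Bounded measurable functions and their integrals *)

Section bounded_measurable.
Context {R : realType}.

Definition bmeas d (T : measurableType d) (f : T -> R) : Prop :=
  measurable_fun [set: T] f /\ exists M : R, forall x, `|f x| <= M.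

Section closure.
Context d (T : measurableType d).
Implicit Types f g : T -> R.

Lemma bmeas_cst (c : R) : bmeas (fun _ : T => c).
Proof. by split; [exact: measurable_cst|exists `|c|]. Qed.

Lemma bmeasD f g : bmeas f -> bmeas g -> bmeas (fun x => f x + g x).
Proof.
move=> [mf [M fM]] [mg [N gN]]; split; first exact: measurable_funD.
by exists (M + N) => x; rewrite (le_trans (ler_normD _ _))// lerD.
Qed.

Lemma bmeasM f g : bmeas f -> bmeas g -> bmeas (fun x => f x * g x).
Proof.
move=> [mf [M fM]] [mg [N gN]]; split; first exact: measurable_funM.
by exists (M * N) => x; rewrite normrM ler_pM.
Qed.

Lemma bmeasN f : bmeas f -> bmeas (fun x => - f x).
Proof.
move=> [mf [M fM]]; split; first exact: measurable_funN.
by exists M => x; rewrite normrN.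
Qed.

Lemma bmeasB f g : bmeas f -> bmeas g -> bmeas (fun x => f x - g x).
Proof. by move=> bf bg; apply: bmeasD => //; exact: bmeasN. Qed.

Lemma bmeas_norm f : bmeas f -> bmeas (fun x => `|f x|).
Proof.
move=> [mf [M fM]]; split; first exact: measurableT_comp.
by exists M => x; rewrite normr_id.
Qed.

Lemma bmeas_sum (I : Type) (s : seq I) (Q : pred I) (h : I -> T -> R) :
  (forall i, bmeas (h i)) -> bmeas (fun x => \sum_(i <- s | Q i) h i x).
Proof.
move=> bh; elim: s => [|i s IH].
  rewrite (_ : (fun x => _) = fun _ => 0); first exact: bmeas_cst.
  by apply/funext => x; rewrite big_nil.
under eq_fun do rewrite big_cons; case: (Q i) => //; exact: bmeasD.
Qed.

Lemma bmeas_prod (I : Type) (s : seq I) (Q : pred I) (h : I -> T -> R) :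
  (forall i, bmeas (h i)) -> bmeas (fun x => \prod_(i <- s | Q i) h i x).
Proof.
move=> bh; elim: s => [|i s IH].
  rewrite (_ : (fun x => _) = fun _ => 1); first exact: bmeas_cst.
  by apply/funext => x; rewrite big_nil.
under eq_fun do rewrite big_cons; case: (Q i) => //; exact: bmeasM.
Qed.

Lemma bmeas_indic (A : set T) : measurable A -> bmeas (\1_A : T -> R).
Proof.
move=> mA; split; first exact: measurable_indic.
by exists 1 => x; rewrite indicE; case: (_ \in _); rewrite ?normr1 ?normr0.
Qed.

Lemma bmeas_comp d' (T' : measurableType d') (g : T' -> R) (phi : T -> T') :
  measurable_fun [set: T] phi -> bmeas g -> bmeas (fun x => g (phi x)).
Proof.
move=> mphi [mg [M gM]]; split; first exact: measurableT_comp.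
by exists M => x.
Qed.

End closure.

Section integral.
Context d (T : measurableType d) (P : probability T R).
Implicit Types f g : T -> R.

Lemma bmeas_integrable f : bmeas f -> P.-integrable [set: T] (EFin \o f).
Proof.
move=> [mf [M fM]]; apply: measurable_bounded_integrable => //.
  by rewrite ltey_eq fin_num_measure.
by exists M; split; [exact: num_real|move=> x Mx y _; exact: le_trans (fM y) (ltW Mx)].
Qed.

Lemma int_cst (c : R) : \int[P]_x c = c.
Proof. by rewrite Rintegral_cst// [X in fine X]probability_setT mulr1. Qed.

Lemma intD f g : bmeas f -> bmeas g ->
  \int[P]_x (f x + g x) = \int[P]_x f x + \int[P]_x g x.
Proof. by move=> bf bg; rewrite RintegralD//; exact: bmeas_integrable. Qed.

Lemma intB f g : bmeas f -> bmeas g ->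
  \int[P]_x (f x - g x) = \int[P]_x f x - \int[P]_x g x.
Proof. by move=> bf bg; rewrite RintegralB//; exact: bmeas_integrable. Qed.

Lemma intZl (c : R) f : bmeas f -> \int[P]_x (c * f x) = c * \int[P]_x f x.
Proof. by move=> bf; rewrite RintegralZl//; exact: bmeas_integrable. Qed.

Lemma intZr (c : R) f : bmeas f -> \int[P]_x (f x * c) = \int[P]_x f x * c.
Proof. by move=> bf; rewrite RintegralZr//; exact: bmeas_integrable. Qed.

Lemma int_sum (I : Type) (s : seq I) (Q : pred I) (h : I -> T -> R) :
  (forall i, bmeas (h i)) ->
  \int[P]_x (\sum_(i <- s | Q i) h i x) = \sum_(i <- s | Q i) \int[P]_x h i x.
Proof.
move=> bh; elim: s => [|i s IH].
  by rewrite big_nil -[RHS](int_cst 0); congr Rintegral; apply/funext => x; rewrite big_nil.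
rewrite big_cons -IH; under [in LHS]eq_fun do rewrite big_cons.
by case: (Q i) => //; rewrite intD//; exact: bmeas_sum.
Qed.

Lemma int_le f g : bmeas f -> bmeas g -> (forall x, f x <= g x) ->
  \int[P]_x f x <= \int[P]_x g x.
Proof. by move=> bf bg fg; apply: le_Rintegral => //; exact: bmeas_integrable. Qed.

Lemma int_ge0 f : (forall x, 0 <= f x) -> 0 <= \int[P]_x f x.
Proof. by move=> f0; exact: Rintegral_ge0. Qed.

Lemma int_norm_le f (M : R) : bmeas f -> (forall x, `|f x| <= M) ->
  `|\int[P]_x f x| <= M.
Proof.
move=> bf fM; apply: le_trans (le_normr_Rintegral _ _) _ => //.
  exact: bmeas_integrable.
by rewrite -[leRHS]int_cst; apply: int_le => //; [exact: bmeas_norm|exact: bmeas_cst].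
Qed.

Lemma int_indic (A : set T) : measurable A -> \int[P]_x \1_A x = fine (P A).
Proof. by move=> mA; rewrite /Rintegral integral_indic// setIT. Qed.

Lemma int_EFin f : bmeas f ->
  (\int[P]_x (f x)%:E)%E = (\int[P]_x f x)%:E.
Proof.
by move=> bf; rewrite /Rintegral fineK//; apply: integrable_fin_num => //;
  exact: bmeas_integrable.
Qed.

Lemma int_ae f g : bmeas f -> bmeas g -> {ae P, forall x, f x = g x} ->
  \int[P]_x f x = \int[P]_x g x.
Proof.
move=> [mf _] [mg _] fg; congr fine; apply: ae_eq_integral => //.
- exact/measurable_EFinP.
- exact/measurable_EFinP.
- by apply: filterS fg => x /= ->.
Qed.

Lemma int_eq0_ae f : bmeas f -> (forall x, 0 <= f x) -> \int[P]_x f x = 0 ->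
  {ae P, forall x, f x = 0}.
Proof.
move=> bf f0 If; have [mf _] := bf.
have mf' : measurable_fun [set: T] (EFin \o f) by exact/measurable_EFinP.
have := (ae_eq_integral_abs P measurableT mf').1.
have -> : (\int[P]_x `|(EFin \o f) x|)%E = (\int[P]_x (f x)%:E)%E.
  by apply: eq_integral => x _ /=; rewrite ger0_norm.
rewrite int_EFin// If => /(_ erefl).
by apply: filterS => x /(_ I) /= [].
Qed.

(** Test with [h = f - g]. *)
Lemma ae_eq_test f g : bmeas f -> bmeas g ->
  (forall h, bmeas h -> \int[P]_x (h x * f x) = \int[P]_x (h x * g x)) ->
  {ae P, forall x, f x = g x}.
Proof.
move=> bf bg fg; have bfg := bmeasB bf bg.
suff : {ae P, forall x, (f x - g x) * (f x - g x) = 0}.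
  by apply: filterS => x /eqP; rewrite mulf_eq0 orbb subr_eq0 => /eqP.
apply: int_eq0_ae; first exact: bmeasM.
  by move=> x; rewrite -expr2 sqr_ge0.
under [in LHS]eq_fun do rewrite mulrBr.
by rewrite intB ?fg ?subrr//; exact: bmeasM.
Qed.

End integral.

Section fubini.
Context d1 d2 (T1 : measurableType d1) (T2 : measurableType d2).
Context (P : probability T1 R) (Q : probability T2 R).
Implicit Types F : T1 * T2 -> R.

Lemma bmeas_section F x : bmeas F -> bmeas (fun y => F (x, y)).
Proof. by move=> bF; apply: (bmeas_comp _ bF); exact: pair1_measurable. Qed.

Lemma bmeas_section2 F y : bmeas F -> bmeas (fun x => F (x, y)).
Proof. by move=> bF; apply: (bmeas_comp _ bF); exact: pair2_measurable. Qed.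

Lemma bmeas_int F : bmeas F -> bmeas (fun x => \int[Q]_y F (x, y)).
Proof.
move=> bF; have [_ [M FM]] := bF; split; last first.
  by exists M => x; apply: int_norm_le => //; exact: bmeas_section.
have := measurable_fubini_F (bmeas_integrable (\d_(point : T1) \x Q)%E bF).
by move/(measurableT_comp (@fine_measurable R setT measurableT)).
Qed.

Lemma int_prod F : bmeas F ->
  \int[(P \x Q)%E]_z F z = \int[P]_x \int[Q]_y F (x, y).
Proof.
move=> bF; rewrite {1}/Rintegral -integral12_prod_meas1; last exact: bmeas_integrable.
by congr fine; apply: eq_integral => x _; rewrite -int_EFin//; exact: bmeas_section.
Qed.

Lemma int_prod2 F : bmeas F ->
  \int[(P \x Q)%E]_z F z = \int[Q]_y \int[P]_x F (x, y).
Proof.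
move=> bF; rewrite {1}/Rintegral -integral21_prod_meas1; last exact: bmeas_integrable.
by congr fine; apply: eq_integral => x _; rewrite -int_EFin//; exact: bmeas_section2.
Qed.

End fubini.

Section preserving.

Definition mpres d1 d2 (T1 : measurableType d1) (T2 : measurableType d2)
    (P : probability T1 R) (Q : probability T2 R) (phi : T1 -> T2) : Prop :=
  measurable_fun [set: T1] phi /\
  forall A, measurable A -> P (phi @^-1` A) = Q A.

Context d1 d2 (T1 : measurableType d1) (T2 : measurableType d2).
Context (P : probability T1 R) (Q : probability T2 R) (phi : T1 -> T2).

Lemma int_mpres (f : T2 -> R) : mpres P Q phi -> bmeas f ->
  \int[Q]_y f y = \int[P]_x f (phi x).
Proof.
move=> [mphi pQ] bf; pose X : {RV P >-> T2} := mfun_Sub (mem_set mphi).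
rewrite /Rintegral; congr fine; rewrite -[RHS](@integral_distribution _ _ _ _ _ _ X (EFin \o f)).
- by apply: eq_measure_integral => A mA _; exact: esym (pQ A mA).
- by apply/measurable_EFinP; case: bf.
- by apply: (@bmeas_integrable _ _ _ (f \o phi)); exact: bmeas_comp.
Qed.

Lemma mpres_ae (A : T2 -> Prop) : mpres P Q phi -> {ae Q, forall y, A y} ->
  {ae P, forall x, A (phi x)}.
Proof.
move=> [mphi pQ] [N [mN N0 AN]]; exists (phi @^-1` N); split.
- by rewrite -[X in measurable X]setTI; exact: mphi.
- by rewrite pQ.
- by move=> x; exact: AN.
Qed.

End preserving.
End bounded_measurable.

(** * Measure-preserving maps and powers of a probability space *)

Section preserving_maps.
Context {R : realType}.

Lemma prod_probT d1 d2 (T1 : measurableType d1) (T2 : measurableType d2)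
    (P : probability T1 R) (Q : probability T2 R) A B :
  measurable A -> measurable B -> (P \x Q)%E (A `*` B) = (P A * Q B)%E.
Proof. by move=> mA mB; rewrite product_measure1E. Qed.

Lemma mpres_int d1 d2 (T1 : measurableType d1) (T2 : measurableType d2)
    (P : probability T1 R) (Q : probability T2 R) (phi : T1 -> T2) :
  measurable_fun [set: T1] phi ->
  (forall f : T2 -> R, bmeas f -> \int[Q]_y f y = \int[P]_x f (phi x)) ->
  mpres P Q phi.
Proof.
move=> mphi PQ; split=> // A mA.
have mphiA : measurable (phi @^-1` A) by rewrite -[X in measurable X]setTI; exact: mphi.
have := PQ _ (bmeas_indic mA); rewrite int_indic//.
rewrite (_ : (fun x => \1_A (phi x)) = \1_(phi @^-1` A))// int_indic// => e.
by rewrite -[LHS]fineK ?fin_num_measure// -e fineK ?fin_num_measure.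
Qed.

Lemma mpres_comp d1 d2 d3 (T1 : measurableType d1) (T2 : measurableType d2)
    (T3 : measurableType d3) (P1 : probability T1 R) (P2 : probability T2 R)
    (P3 : probability T3 R) (f : T1 -> T2) (g : T2 -> T3) :
  mpres P1 P2 f -> mpres P2 P3 g -> mpres P1 P3 (g \o f).
Proof.
move=> [mf fE] [mg gE]; split=> [|A mA]; first exact: measurableT_comp.
have mgA : measurable (g @^-1` A) by rewrite -[X in measurable X]setTI; exact: mg.
by rewrite comp_preimage fE// gE.
Qed.

Lemma mpres_prod d1 d2 d3 d4 (T1 : measurableType d1) (T2 : measurableType d2)
    (T3 : measurableType d3) (T4 : measurableType d4)
    (P1 : probability T1 R) (P2 : probability T2 R)
    (P3 : probability T3 R) (P4 : probability T4 R)
    (f : T1 -> T2) (g : T3 -> T4) :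
  mpres P1 P2 f -> mpres P3 P4 g ->
  mpres (P1 \x P3)%E (P2 \x P4)%E (fun z => (f z.1, g z.2)).
Proof.
move=> Pf Pg; have [mf _] := Pf; have [mg _] := Pg.
have mfg : measurable_fun [set: T1 * T3] (fun z => (f z.1, g z.2)).
  by apply: measurable_fun_pair; exact: measurableT_comp.
apply: mpres_int => // F bF; rewrite int_prod// (int_mpres Pf); last exact: bmeas_int.
rewrite (@int_prod _ _ _ _ _ P1 P3 (fun z => F (f z.1, g z.2))); last exact: bmeas_comp.
congr Rintegral; apply/funext => x /=.
by rewrite (int_mpres Pg)//; exact: bmeas_section.
Qed.

Lemma mpres_distr d1 d2 d3 (T1 : measurableType d1) (T2 : measurableType d2)
    (T3 : measurableType d3) (P1 : probability T1 R)
    (X : {mfun T1 >-> T2}) (Q : probability T3 R) (g : T2 -> T3) :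
  measurable_fun [set: T2] g -> mpres P1 Q (g \o X) ->
  mpres (distribution P1 X) Q g.
Proof. by move=> mg [_ gE]; split=> // A mA; exact: gE. Qed.

Lemma mpres_distribution d1 d2 (T1 : measurableType d1) (T2 : measurableType d2)
    (P1 : probability T1 R) (X : {mfun T1 >-> T2}) :
  mpres P1 (distribution P1 X) X.
Proof. by split. Qed.

(** In particular, exchanging the inner factors carries the square of a product to the
    product of the squares; this is what makes densities of tensor products of
    kernels factor. *)
Lemma mpres_interchange d1 d2 d3 d4 (T1 : measurableType d1)
    (T2 : measurableType d2) (T3 : measurableType d3) (T4 : measurableType d4)
    (P1 : probability T1 R) (P2 : probability T2 R)
    (P3 : probability T3 R) (P4 : probability T4 R) :
  mpres ((P1 \x P2) \x (P3 \x P4))%E ((P1 \x P3) \x (P2 \x P4))%E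
    (fun z => ((z.1.1, z.2.1), (z.1.2, z.2.2))).
Proof.
have m11 : measurable_fun [set: (T1 * T2) * (T3 * T4)] (fun z => z.1.1).
  exact: (measurableT_comp measurable_fst measurable_fst).
have m12 : measurable_fun [set: (T1 * T2) * (T3 * T4)] (fun z => z.1.2).
  exact: (measurableT_comp measurable_snd measurable_fst).
have m21 : measurable_fun [set: (T1 * T2) * (T3 * T4)] (fun z => z.2.1).
  exact: (measurableT_comp measurable_fst measurable_snd).
have m22 : measurable_fun [set: (T1 * T2) * (T3 * T4)] (fun z => z.2.2).
  exact: (measurableT_comp measurable_snd measurable_snd).
have msw : measurable_fun [set: (T1 * T2) * (T3 * T4)]
    (fun z => ((z.1.1, z.2.1), (z.1.2, z.2.2))).
  by apply: measurable_fun_pair; exact: measurable_fun_pair.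
apply: mpres_int => // F bF.
have bFs := bmeas_comp msw bF.
rewrite int_prod//= [RHS]int_prod//=.
rewrite int_prod; last exact: bmeas_int.
rewrite [RHS]int_prod; last exact: (bmeas_int (P3 \x P4)%E bFs).
congr Rintegral; apply/funext => x /=.
transitivity (\int[P3]_z \int[P2]_y \int[P4]_t F ((x, z), (y, t))).
  congr Rintegral; apply/funext => z /=; rewrite int_prod//=; exact: bmeas_section.
transitivity (\int[P2]_y \int[P3]_z \int[P4]_t F ((x, z), (y, t))); last first.
  congr Rintegral; apply/funext => y /=.
  by rewrite int_prod//; exact: (@bmeas_section _ _ _ _ _ _ (x, y) bFs).
pose G (q : T2 * T3) := \int[P4]_t F ((x, q.2), (q.1, t)).
have bG : bmeas G.
  apply: (@bmeas_int _ _ _ _ _ P4 (fun w : (T2 * T3) * T4 => F ((x, w.1.2), (w.1.1, w.2)))).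
  apply: (bmeas_comp _ bF).
  apply: measurable_fun_pair; apply: measurable_fun_pair.
  - exact: measurable_cst.
  - exact: (measurableT_comp measurable_snd measurable_fst).
  - exact: (measurableT_comp measurable_fst measurable_fst).
  - exact: measurable_snd.
by rewrite -(@int_prod _ _ _ _ _ P2 P3 G)// -(@int_prod2 _ _ _ _ _ P2 P3 G).
Qed.

End preserving_maps.

Section powers.
Context {R : realType}.

Lemma measurable_map_tuple d1 d2 (T1 : measurableType d1)
    (T2 : measurableType d2) (phi : T1 -> T2) n :
  measurable_fun [set: T1] phi ->
  measurable_fun [set: n.-tuple T1] (map_tuple phi : n.-tuple T1 -> n.-tuple T2).
Proof.
move=> mphi; apply/measurable_fun_tnthP => i.
rewrite (_ : _ \o _ = phi \o (fun t => tnth t i)); last first.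
  by apply/funext => t /=; rewrite tnth_map.
by apply: measurableT_comp => //; exact: measurable_tnth.
Qed.

Lemma int_power0 d (T : measurableType d) (P : probability T R)
    (f : 0.-tuple T -> R) : \int[power_prob P 0]_x f x = f [tuple].
Proof.
rewrite -[RHS](int_cst (power_prob P 0)); congr Rintegral; apply/funext => x.
by rewrite tuple0.
Qed.

Lemma int_powerS d (T : measurableType d) (P : probability T R) n
    (f : n.+1.-tuple T -> R) : bmeas f ->
  \int[power_prob P n.+1]_x f x =
  \int[P]_x \int[power_prob P n]_t f (cons_pair (x, t)).
Proof.
move=> bf; rewrite (int_mpres (mpres_distribution _ _) bf) int_prod//.
by apply: (bmeas_comp _ bf); exact: measurable_cons_pair.
Qed.

Lemma mpres_power d1 d2 (T1 : measurableType d1) (T2 : measurableType d2)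
    (P : probability T1 R) (Q : probability T2 R) (phi : T1 -> T2) n :
  mpres P Q phi ->
  mpres (power_prob P n) (power_prob Q n) (map_tuple phi).
Proof.
move=> Pphi; have [mphi _] := Pphi.
elim: n => [|n IH].
  apply: mpres_int => [|f bf]; first exact: measurable_map_tuple.
  rewrite !int_power0; congr f; exact/val_inj.
apply: mpres_distr; first exact: measurable_map_tuple.
have := mpres_comp (mpres_prod Pphi IH) (mpres_distribution _ (@cons_pair _ _ n)).
rewrite (_ : _ \o _ = map_tuple phi \o cons_pair (n := n))//.
by apply/funext => -[x t]; exact/val_inj.
Qed.

(** A tuple of independent pairs is a pair of independent tuples. *)
Lemma mpres_unzip d1 d2 (T1 : measurableType d1) (T2 : measurableType d2)
    (P : probability T1 R) (Q : probability T2 R) n :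
  mpres (power_prob (P \x Q)%E n) (power_prob P n \x power_prob Q n)%E
    (fun x => (map_tuple fst x, map_tuple snd x)).
Proof.
have mun k : measurable_fun [set: k.-tuple (T1 * T2)]
    (fun x => (map_tuple fst x : k.-tuple T1, map_tuple snd x : k.-tuple T2)).
  by apply: measurable_fun_pair; exact: measurable_map_tuple.
elim: n => [|n IH].
  apply: mpres_int => [|f bf]; [exact: mun|rewrite int_power0].
  rewrite -[RHS](int_cst (power_prob P 0 \x power_prob Q 0)%E).
  congr Rintegral; apply/funext => -[x y]; rewrite (tuple0 x) (tuple0 y).
  by congr f; congr pair; exact/val_inj.
apply: mpres_distr; first exact: mun.
have c1 := mpres_distribution (P \x power_prob P n)%E (@cons_pair _ T1 n).
have c2 := mpres_distribution (Q \x power_prob Q n)%E (@cons_pair _ T2 n).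
have hid : mpres (P \x Q)%E (P \x Q)%E id by split; [exact: measurable_id|].
have h := mpres_comp (mpres_prod hid IH) (mpres_interchange P Q (power_prob P n) (power_prob Q n)).
have := mpres_comp h (mpres_prod c1 c2).
rewrite (_ : _ \o _ = (fun x => (map_tuple fst x, map_tuple snd x)) \o cons_pair (n := n))//.
by apply/funext => -[x t]; congr pair; exact/val_inj.
Qed.

End powers.

(** * Standard and atomless spaces *)

Lemma mpres_exists {R : realType} d1 d2 (T1 : measurableType d1)
    (T2 : measurableType d2) (P : probability T1 R) (phi : T1 -> T2) :
  measurable_fun [set: T1] phi -> exists Q : probability T2 R, mpres P Q phi.
Proof.
move=> mphi; pose X : {mfun T1 >-> T2} := mfun_Sub (mem_set mphi).
by exists (distribution P X); split.
Qed.

Lemma preimage_measurable d1 d2 (T1 : measurableType d1)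
    (T2 : measurableType d2) (phi : T1 -> T2) A :
  measurable_fun [set: T1] phi -> measurable A -> measurable (phi @^-1` A).
Proof. by move=> mphi mA; rewrite -[X in measurable X]setTI; exact: mphi. Qed.

Section standard_spaces.
Context {R : realType} d (T : measurableType d) (P : probability T R).

Lemma prob_bigcup0 (F : (set T)^nat) : (forall n, measurable (F n)) ->
  (forall n, P (F n) = 0%E) -> P (\bigcup_n F n) = 0%E.
Proof.
move=> mF F0; have mU : measurable (\bigcup_n F n) by exact: bigcupT_measurable.
apply/(negligibleP P mU); apply: negligible_bigcup => n.
exact: (negligibleP P (mF n)).2 (F0 n).
Qed.

Lemma prob_setI1 (X A : set T) : measurable X -> measurable A -> P X = 1%E ->
  P (X `&` A) = P A.
Proof.
move=> mX mA PX; rewrite [RHS](measureDI P mA mX) setIC.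
rewrite [X in (X + _)%E](_ : _ = 0%E) ?add0e//.
apply/eqP; rewrite eq_le measure_ge0 andbT.
have <- : P (~` X) = 0%E by rewrite probability_setC// PX subee.
apply: le_measure; last by move=> x [].
  by rewrite inE; exact: measurableD.
by rewrite inE; exact: measurableC.
Qed.

(** Rokhlin's condition only asks for a real coordinate that is injective, with
    a measurable inverse, on a set of full measure: the law of the coordinate
    is then the measure on the line. *)
Lemma standardP : standard P <->
  exists (f : T -> R) (g : R -> T) (X : set T),
    [/\ measurable_fun [set: T] f, measurable_fun [set: R] g, measurable X,
        P X = 1%E & forall x, X x -> g (f x) = x].
Proof.
split.
  move=> [Q [X [Y [f [g [[mX mY PX QY] [[fXY gYX gf fg] [mf mg PQ]]]]]]]].
  exists (f \_ X), (g \_ Y), X; split => //.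
  - exact/(measurable_restrictT _ mX).
  - exact/(measurable_restrictT _ mY).
  - by move=> x Xx; rewrite !patchE !mem_set//; [exact: gf|exact: fXY].
move=> [f [g [X [mf mg mX PX gf]]]].
have [Q [_ PQ]] := @mpres_exists R _ _ _ (measurableTypeR R) P f mf.
pose Y := (g @^-1` X) `&` [set y | f (g y) = y].
have mY : measurable (Y : set (measurableTypeR R)).
  apply: measurableI; first exact: preimage_measurable.
  have mfg : measurable_fun [set: R] (fun y => f (g y) == y).
    by apply: measurable_fun_eqr; [exact: measurableT_comp|exact: measurable_id].
  rewrite (_ : [set _ | _] = [set: R] `&` (fun y => f (g y) == y) @^-1` [set true]).
    exact: mfg.
  by apply/seteqP; split => y /= => [fgy|[_ /eqP]//]; split=> //; exact/eqP.
have XfY : X `<=` f @^-1` Y by move=> x Xx; split => /=; rewrite gf.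
exists Q, X, Y, f, g; split; [split => //|split; [split => //|split => //]].
- apply/eqP; rewrite eq_le probability_le1//= -PX -PQ//; apply: le_measure => //.
  + by rewrite inE.
  + by rewrite inE; exact: (@preimage_measurable _ _ T (measurableTypeR R) f Y mf mY).
- by move=> y [].
- by move=> y [].
- exact: measurable_funTS.
- exact: measurable_funTS.
- move=> B mB BY; rewrite -PQ//; apply: prob_setI1 => //.
  exact: (@preimage_measurable _ _ T (measurableTypeR R) f B mf mB).
Qed.

(** If every measurable part of [A] had measure [0] or [P A], the distribution
    function of [f] on [A] would jump from one to the other at a point, which
    would then carry all of [A]. *)
Lemma diffuse_atomless (f : T -> R) : measurable_fun [set: T] f ->
  (forall r, P (f @^-1` [set r]) = 0%E) -> atomless P.
Proof.
move=> mf f0 A mA A_gt0; apply: contrapT => nB.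
have PB B : measurable B -> B `<=` A -> P B <> 0%E -> P B = P A.
  move=> mB BA B0; apply/eqP; rewrite eq_le le_measure ?inE//= leNgt.
  apply/negP => PBA; apply: nB; exists B; split => //.
  by rewrite lt0e measure_ge0 andbT; apply/eqP.
pose G s := A `&` f @^-1` `]-oo, s].
have mG s : measurable (G s).
  by apply: measurableI => //; apply: preimage_measurable => //; exact: measurable_itv.
have GA s : G s `<=` A by move=> x [].
have Gle s t : s <= t -> (P (G s) <= P (G t))%E.
  move=> st; apply: le_measure; rewrite ?inE// => x [Ax] /=; rewrite !in_itv/= => fs.
  by split=> //=; rewrite in_itv/= (le_trans fs).
have DG s : P (G s) <> 0%E -> P (A `\` G s) = 0%E.
  move=> Gs0; rewrite measureD//; last by rewrite ltey_eq fin_num_measure.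
  by rewrite setIidr// [X in (_ - X)%E]PB// subee// fin_num_measure.
pose S : set R := [set s | P (G s) = 0%E].
have A0 : P A <> 0%E by move=> PA0; move: A_gt0; rewrite PA0 ltxx.
have S0 : S !=set0.
  apply: contrapT => nS; apply: A0.
  rewrite (_ : A = \bigcup_n (A `\` G (- n%:R))).
    apply: prob_bigcup0 => n; first exact: measurableD.
    by apply: DG => Gn0; apply: nS; exists (- n%:R).
  apply/seteqP; split=> [x Ax|x [n _ []]//].
  exists (Num.truncn (- f x)).+1 => //; split => // -[_] /=.
  by rewrite in_itv/= leNgt ltrNl truncnS_gt.
have [n Gn0] : exists n : nat, P (G n%:R) <> 0%E.
  apply: contrapT => nG; apply: A0.
  rewrite (_ : A = \bigcup_n G n%:R).
    apply: prob_bigcup0 => // n; apply: contrapT => Gn; apply: nG; by exists n.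
  apply/seteqP; split=> [x Ax|x [n _ []]//].
  exists (Num.truncn (f x)).+1 => //; split => //=.
  by rewrite in_itv/= ltW// truncnS_gt.
have Sub : has_ubound S.
  exists n%:R => s Ss; rewrite leNgt; apply/negP => /ltW/Gle.
  by rewrite Ss => ns; apply: Gn0; apply/eqP; rewrite eq_le ns/=.
have hS : has_sup S by [].
pose s0 := sup S.
apply: A0; rewrite (_ : A = (\bigcup_n G (s0 - n.+1%:R^-1)) `|`
    ((A `&` f @^-1` [set s0]) `|` \bigcup_n (A `\` G (s0 + n.+1%:R^-1)))); last first.
  apply/seteqP; split=> [x Ax|x]; last by move=> [[n' _ []]//|[[]//|[n' _ []]//]].
  have [fx|fx|fx] := ltgtP (f x) s0; [left|right; right|right; left] => //.
    have [k fk] := ltr_add_invr fx.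
    by exists k => //; split=> //=; rewrite in_itv/= lerBrDr ltW.
  have [k fk] := ltr_add_invr fx; exists k => //; split=> // -[_] /=.
  by rewrite in_itv/= leNgt fk.
have mf0 : measurable (A `&` f @^-1` [set s0]).
  by apply: measurableI => //; exact: preimage_measurable.
apply/negligibleP.
  by apply: measurableU; [|apply: measurableU => //];
    apply: bigcupT_measurable => // k; exact: measurableD.
apply: negligibleU; [|apply: negligibleU].
- apply: negligible_bigcup => k; apply/negligibleP => //.
  have [|s Ss ss] := @sup_adherent _ S k.+1%:R^-1 _ hS; first by rewrite invr_gt0.
  by apply/eqP; rewrite eq_le measure_ge0 andbT -Ss Gle// ltW.
- apply/negligibleP => //; apply/eqP; rewrite eq_le measure_ge0 andbT -(f0 s0).
  by apply: le_measure; rewrite ?inE//; exact: preimage_measurable.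
- apply: negligible_bigcup => k; apply/negligibleP; first exact: measurableD.
  apply: DG => Gk; have := ub_le_sup Sub Gk.
  by rewrite leNgt ltrDl invr_gt0 ltr0n.
Qed.

Lemma atomless_diffuse (f : T -> R) (g : R -> T) (X : set T) :
  atomless P -> measurable_fun [set: T] f -> measurable X -> P X = 1%E ->
  (forall x, X x -> g (f x) = x) -> forall r, P (f @^-1` [set r]) = 0%E.
Proof.
move=> atP mf mX PX gf r.
have mr : measurable (f @^-1` [set r]) by exact: preimage_measurable.
rewrite -(prob_setI1 mX mr PX); apply: contrapT => P0.
have [||B [mB BA B0 BltA]] := atP (X `&` f @^-1` [set r]).
- exact: measurableI.
- by rewrite lt0e measure_ge0 andbT; apply/eqP.
have [B_eq0|/eqP/set0P[b Bb]] := pselect (B = set0).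
  by rewrite B_eq0 measure0 ltxx in B0.
suff BE : B = X `&` f @^-1` [set r] by rewrite BE ltxx in BltA.
apply/seteqP; split=> // x [Xx fx].
have [Xb fb] := BA _ Bb.
by rewrite -(gf x Xx) fx -fb gf.
Qed.

End standard_spaces.

Lemma standard_lambda01 (R : realType) : standard (lambda01 R).
Proof.
apply/standardP; exists idfun, idfun, setT.
by split=> //; [exact: measurable_id|exact: measurable_id|exact: probability_setT].
Qed.

Lemma atomless_lambda01 (R : realType) : atomless (lambda01 R).
Proof.
apply: (@diffuse_atomless _ _ _ (lambda01 R) idfun) => [|r].
  exact: (@measurable_id _ (measurableTypeR R)).
rewrite /lambda01/= /mrestr; apply/eqP; rewrite eq_le measure_ge0 andbT.
rewrite -(lebesgue_measure_set1 r); apply: le_measure; rewrite ?inE//.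
exact: (measurableI _ _ (measurable_set1 r) (measurable_itv `[0, 1])).
Qed.

(** * Products of standard spaces *)

Section binary_codes.
Context {R : realType}.
Implicit Types b : nat -> bool.

(** Base 4, so that the code of the tail stays below [1/3] and the leading digit
    can be read off by a comparison. *)
Fixpoint code_part (n : nat) b : R :=
  if n is m.+1 then ((b 0%N)%:R + code_part m (fun k => b k.+1)) / 4 else 0.

Definition code b : R := limn (code_part ^~ b).

Lemma code_part_bounds n b : 0 <= code_part n b <= 1 / 3.
Proof.
elim: n b => [|n IH] b /=; first by apply/andP; split; lra.
have /andP[c0 c1] := IH (fun k => b k.+1).
by apply/andP; split; case: (b 0%N) => /=; lra.
Qed.

Lemma code_part_nd b : nondecreasing_seq (code_part ^~ b).
Proof.
apply/nondecreasing_seqP => n; elim: n b => [|n IH] b.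
  by have /andP[] := code_part_bounds 1 b.
by have := IH (fun k => b k.+1); rewrite /=; lra.
Qed.

Lemma cvg_code b : code_part ^~ b @ \oo --> code b.
Proof.
apply: nondecreasing_is_cvgn; first exact: code_part_nd.
by exists (1 / 3) => _ [n _ <-]; have /andP[] := code_part_bounds n b.
Qed.

Lemma code_bounds b : 0 <= code b <= 1 / 3.
Proof.
apply/andP; split.
  by apply: (cvgr_to_ge (@cvg_code b)); near=> n; have /andP[] := code_part_bounds n b.
by apply: (cvgr_to_le (@cvg_code b)); near=> n; have /andP[] := code_part_bounds n b.
Unshelve. all: by end_near. Qed.

Lemma codeS b : code b = ((b 0%N)%:R + code (fun k => b k.+1)) / 4.
Proof.
rewrite [LHS]/code; apply: (@cvg_lim R) => //; rewrite -cvg_shiftS/=.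
apply: cvgM; last exact: cvg_cst.
by apply: cvgD; [exact: cvg_cst|exact: cvg_code].
Qed.

Fixpoint digit (n : nat) (x : R) : bool :=
  if n is m.+1 then digit m (4 * x - (1 <= 4 * x)%R%:R) else 1 <= 4 * x.

Lemma digit_code n b : digit n (code b) = b n.
Proof.
have d0 c : (1 <= 4 * code c) = c 0%N.
  have /andP[c0 c1] := code_bounds (fun k => c k.+1).
  by rewrite codeS; case: (c 0%N) => /=; apply/idP; [|apply/negP; rewrite -ltNge]; lra.
elim: n b => [|n IH] b /=; first exact: d0.
rewrite d0 codeS -(IH (fun k => b k.+1)); by congr digit; lra.
Qed.

Lemma measurable_bool_natr d (T : measurableType d) (c : T -> bool) :
  measurable_fun [set: T] c -> measurable_fun [set: T] (fun x => (c x)%:R : R).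
Proof.
move=> mc; rewrite (_ : (fun x => _) = fun x => if c x then 1 else 0); last first.
  by apply/funext => x; case: (c x).
by apply: measurable_fun_ifT => //; exact: measurable_cst.
Qed.

Lemma measurable_digit n : measurable_fun [set: R] (digit n).
Proof.
have m4 : measurable_fun [set: R] (fun x => 4 * x).
  exact: measurable_funM (measurable_cst _) (@measurable_id _ _ _).
have m0 : measurable_fun [set: R] (fun x => 1 <= 4 * x).
  exact: measurable_fun_ler (measurable_cst _) m4.
elim: n => [//|n IH]; apply: (measurableT_comp IH).
apply: measurable_funB => //.
exact: measurable_bool_natr.
Qed.

Lemma measurable_code d (T : measurableType d) (b : T -> nat -> bool) :
  (forall n, measurable_fun [set: T] (fun x => b x n)) ->
  measurable_fun [set: T] (fun x => code (b x)).
Proof.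
move=> mb; apply: (@measurable_fun_cvg _ _ _ _ (fun n x => code_part n (b x))).
  move=> n; elim: n b mb => [|n IH] b mb /=; first exact: measurable_cst.
  apply: measurable_funM; last exact: measurable_cst.
  apply: measurable_funD; last by apply: (IH (fun x k => b x k.+1)) => k; exact: mb.
  exact: measurable_bool_natr.
by move=> x _; exact: cvg_code.
Qed.

Definition ratn (n : nat) : R := ratr (odflt 0 (unpickle n : option rat)).

(** Recovers a real number from its upper Dedekind cut in the rational numbers. *)
Definition cut_inf b : R :=
  fine (einfs (fun n => if b n then (ratn n)%:E else +oo%E) 0%N).

Lemma cut_infE (x : R) : cut_inf (fun n => x < ratn n) = x.
Proof.
suff E : einfs (fun n => if x < ratn n then (ratn n)%:E else +oo%E) 0%N = x%:E.
  by rewrite /cut_inf E.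
apply/eqP; rewrite eq_le; apply/andP; split; last first.
  apply: le_ereal_inf_tmp => _ [n _ <-].
  by case: ifPn => [xq|_]; rewrite ?leey// lee_fin ltW.
apply/lee_addgt0Pr => e e0.
have xe : x < x + e by rewrite ltrDl.
have [q] := rat_in_itvoo xe; rewrite in_itv/= => /andP[xq qe].
have qE : ratn (pickle q) = ratr q by rewrite /ratn pickleK.
apply: le_trans (ereal_inf_lbound _) _; first by exists (pickle q).
by rewrite qE xq lee_fin ltW.
Qed.

Lemma measurable_cut_inf d (T : measurableType d) (b : T -> nat -> bool) :
  (forall n, measurable_fun [set: T] (fun x => b x n)) ->
  measurable_fun [set: T] (fun x => cut_inf (b x)).
Proof.
move=> mb; apply: (measurableT_comp (@fine_measurable R setT measurableT)).
apply: (@measurable_fun_einfs _ _ _ _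
  (fun n x => if b x n then (ratn n)%:E else +oo%E)).
by move=> n; apply: measurable_fun_ifT => //; exact: measurable_cst.
Qed.

(** The plane is a measurable retract of the line: interleave the codes of the
    two Dedekind cuts. *)
Definition zip_line (z : R * R) : R :=
  code (fun n => if odd n then z.2 < ratn n./2 else z.1 < ratn n./2).

Definition unzip_line (y : R) : R * R :=
  (cut_inf (fun n => digit n.*2 y), cut_inf (fun n => digit n.*2.+1 y)).

Lemma zip_lineK z : unzip_line (zip_line z) = z.
Proof.
case: z => x y; congr pair.
  rewrite -[RHS]cut_infE; congr cut_inf; apply/funext => n.
  by rewrite /zip_line digit_code /= odd_double doubleK.
rewrite -[RHS]cut_infE; congr cut_inf; apply/funext => n.
by rewrite /zip_line digit_code /= odd_double /= uphalf_double.
Qed.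

Lemma measurable_zip_line : measurable_fun [set: R * R] zip_line.
Proof.
apply: measurable_code => n; case: (odd n).
- by apply: measurable_fun_ltr; [exact: measurable_snd|exact: measurable_cst].
- by apply: measurable_fun_ltr; [exact: measurable_fst|exact: measurable_cst].
Qed.

Lemma measurable_unzip_line : measurable_fun [set: R] unzip_line.
Proof.
by apply: measurable_fun_pair; apply: measurable_cut_inf => n; exact: measurable_digit.
Qed.

End binary_codes.

Section product_spaces.
Context {R : realType} d1 d2 (T1 : measurableType d1) (T2 : measurableType d2).
Context (P : probability T1 R) (Q : probability T2 R).

Lemma standard_prod : standard P -> standard Q -> standard (P \x Q)%E.
Proof.
move=> /standardP[f [g [X [mf mg mX PX gf]]]] /standardP[f' [g' [X' [mf' mg' mX' PX' gf']]]].
apply/standardP; exists (fun z => zip_line (f z.1, f' z.2)),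
  (fun y => (g (unzip_line y).1, g' (unzip_line y).2)), (X `*` X'); split.
- apply: (measurableT_comp measurable_zip_line).
  by apply: measurable_fun_pair; apply: measurableT_comp.
- apply: measurable_fun_pair.
  + apply: (measurableT_comp mg).
    by apply: (measurableT_comp measurable_fst); exact: measurable_unzip_line.
  + apply: (measurableT_comp mg').
    by apply: (measurableT_comp measurable_snd); exact: measurable_unzip_line.
- exact: measurableX.
- by transitivity (P X * Q X')%E; [exact: prod_probT|rewrite PX PX' mule1].
- move=> [x y] [Xx Xy].
  change ((g (unzip_line (zip_line (f x, f' y))).1,
    g' (unzip_line (zip_line (f x, f' y))).2) = (x, y)).
  by rewrite zip_lineK/= gf// gf'.
Qed.

(** The first coordinate alone has no point masses. *)
Lemma atomless_prod : standard P -> atomless P -> atomless (P \x Q)%E.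
Proof.
move=> /standardP[f [g [X [mf mg mX PX gf]]]] atP.
have mf1 : measurable_fun [set: T1 * T2] (fun z => f z.1) by exact: measurableT_comp.
apply: (diffuse_atomless mf1) => r.
rewrite (_ : _ @^-1` _ = (f @^-1` [set r]) `*` setT); last first.
  by apply/seteqP; split=> [z //|z []].
transitivity (P (f @^-1` [set r]) * Q setT)%E.
  by apply: prod_probT => //; exact: preimage_measurable.
by rewrite (atomless_diffuse atP mf mX PX gf) mul0e.
Qed.

End product_spaces.

(** * Step functions and weighted measures *)

Section step_functions.
Context {R : realType} d (T : measurableType d).

Lemma bmeas_step (f : T -> R) (a b e : R) : measurable_fun [set: T] f ->
  (forall x, a <= f x <= b) -> 0 < e ->
  exists (N : nat) (A : nat -> set T), [/\ forall k, measurable (A k),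
    trivIset [set: nat] A,
    forall x, exists2 k, (k < N)%N & A k x &
    forall k x, A k x -> a + k%:R * e <= f x < a + k.+1%:R * e].
Proof.
move=> mf fab e0; pose A k := f @^-1` `[a + k%:R * e, a + k.+1%:R * e[.
have AE k x : A k x = (a + k%:R * e <= f x < a + k.+1%:R * e).
  by rewrite /A /= in_itv/=.
have Ak x : exists2 k, A k x & k = Num.truncn ((f x - a) / e).
  exists (Num.truncn ((f x - a) / e)) => //.
  have /andP[fa _] := fab x.
  have /Num.Theory.truncn_itv/andP[h1 h2] : 0 <= (f x - a) / e.
    by rewrite divr_ge0// ?subr_ge0// ltW.
  rewrite AE -lerBrDl -ltrBlDl; apply/andP; split.
    by rewrite -ler_pdivlMr.
  by rewrite -ltr_pdivrMr.
exists (Num.truncn ((b - a) / e)).+1, A; split.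
- by move=> k; apply: preimage_measurable => //; exact: measurable_itv.
- apply/trivIsetP => i j _ _; wlog ij : i j / (i < j)%N => [h|_].
    by rewrite neq_ltn => /orP[ij|ji]; [|rewrite setIC]; apply: h => //; rewrite ltn_eqF.
  apply/seteqP; split=> // x []; rewrite !AE => /andP[_ h1] /andP[h2 _].
  have : i.+1%:R <= j%:R :> R by rewrite ler_nat.
  rewrite -(ler_pM2r e0) leNgt => /negP; apply.
  by rewrite -(ltrD2l a); exact: le_lt_trans h1.
- move=> x; have [k Akx kE] := Ak x; exists k => //.
  rewrite ltnS kE; apply: le_truncn.
  by rewrite ler_pM2r ?invr_gt0// lerD2r; have /andP[] := fab x.
- by move=> k x; rewrite AE.
Qed.

Lemma sum_indic (N : nat) (A : nat -> set T) (c : nat -> R) k x :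
  trivIset [set: nat] A -> (k < N)%N -> A k x ->
  \sum_(i < N) c i * \1_(A i) x = c k.
Proof.
move=> tA kN Ax; rewrite (bigD1 (Ordinal kN))//= indicE mem_set// mulr1.
rewrite big1 ?addr0// => i ik; rewrite indicE memNset ?mulr0// => Ai.
by move/eqP: ik; apply; apply/val_inj; apply: (tA i k) => //; exists x.
Qed.

(** Step functions are uniformly dense among the bounded measurable functions. *)
Lemma bmeas_ind (Phi : (T -> R) -> Prop) :
  (forall A, measurable A -> Phi \1_A) ->
  (forall f g, bmeas f -> bmeas g -> Phi f -> Phi g -> Phi (fun x => f x + g x)) ->
  (forall c f, bmeas f -> Phi f -> Phi (fun x => c * f x)) ->
  (forall f, bmeas f ->
    (forall e, 0 < e -> exists g, [/\ bmeas g, Phi g & forall x, `|f x - g x| <= e]) ->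
    Phi f) ->
  forall f, bmeas f -> Phi f.
Proof.
move=> PI PD PZ PL f bf; have [mf [M fM]] := bf.
apply: PL => // e e0.
have fab x : - M <= f x <= M by rewrite -ler_norml.
have [N [A [mA tA cA Ae]]] := bmeas_step mf fab e0.
pose c k : R := - M + k%:R * e.
pose g n x : R := \sum_(i < n) c i * \1_(A i) x.
have bterm n : bmeas (fun x => c n * \1_(A n) x).
  by apply: bmeasM; [exact: bmeas_cst|exact: bmeas_indic].
have bg n : bmeas (g n) by apply: bmeas_sum => i.
exists (g N); split => //.
- elim: N {cA} => [|n IH].
    rewrite (_ : g 0%N = fun x => 0 * \1_setT x).
      by apply: PZ; [exact: bmeas_indic|exact: PI].
    by apply/funext => x; rewrite /g big_ord0 mul0r.
  rewrite (_ : g n.+1 = fun x => g n x + c n * \1_(A n) x).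
    by apply: PD => //; apply: PZ; [exact: bmeas_indic|exact: PI].
  by apply/funext => x; rewrite /g big_ord_recr.
- move=> x; have [k kN Akx] := cA x.
  rewrite /g (sum_indic c tA kN Akx); have /andP[h1 h2] := Ae _ _ Akx.
  rewrite ger0_norm /c ?subr_ge0// lerBlDl.
  by move: h2; rewrite -natr1; lra.
Qed.

End step_functions.

Section weighted_measure.
Context {R : realType} d (T : measurableType d) (P : probability T R).
Context (w : T -> R) (bw : bmeas w) (w0 : forall x, 0 <= w x).
Hypothesis w1 : \int[P]_x w x = 1.

Definition weighted (A : set T) : \bar R := (\int[P]_(x in A) (w x)%:E)%E.

Let weighted0 : weighted set0 = 0%E.
Proof. by rewrite /weighted integral_set0. Qed.

Let weighted_ge0 A : (0 <= weighted A)%E.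
Proof. by apply: integral_ge0 => x _; rewrite lee_fin. Qed.

Let weighted_sigma_additive : semi_sigma_additive weighted.
Proof.
move=> /= F mF tF mUF; rewrite /weighted; apply: cvg_toP.
  apply: ereal_nondecreasing_is_cvgn => m n mn.
  apply: lee_sum_nneg_natr => // k _ _.
  by apply: integral_ge0 => /= x Fkx; rewrite lee_fin.
rewrite ge0_integral_bigcup//=.
- by apply: measurable_funTS; apply/measurable_EFinP; case: bw.
- by move=> x _; rewrite lee_fin.
Qed.

HB.instance Definition _ := isMeasure.Build _ _ _ weighted
  weighted0 weighted_ge0 weighted_sigma_additive.

Let weighted_setT : weighted [set: _] = 1%E.
Proof. by rewrite /weighted int_EFin// w1. Qed.

HB.instance Definition _ := @Measure_isProbability.Build _ _ R
  weighted weighted_setT.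

Lemma weighted_exists : exists Q : probability T R,
  forall A, measurable A -> Q A = (\int[P]_x (\1_A x * w x))%:E.
Proof.
exists weighted => A mA; rewrite /= /weighted integral_mkcond/=.
rewrite -int_EFin; last by apply: bmeasM => //; exact: bmeas_indic.
apply: eq_integral => x _; rewrite patchE indicE.
by case: ifPn => _; rewrite ?mul1r ?mul0r.
Qed.

End weighted_measure.

Section weighted_integrals.
Context {R : realType} d (T : measurableType d) (P Q : probability T R).

Definition has_density (w : T -> R) : Prop :=
  [/\ bmeas w, forall x, 0 <= w x &
      forall f, bmeas f -> \int[Q]_x f x = \int[P]_x (f x * w x)].

Lemma has_densityI (w : T -> R) : bmeas w -> (forall x, 0 <= w x) ->
  (forall A, measurable A -> Q A = (\int[P]_x (\1_A x * w x))%:E) ->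
  has_density w.
Proof.
move=> bw w0 QE; split=> //.
have w1 : \int[P]_x w x = 1.
  have := QE _ measurableT; rewrite probability_setT => -[->].
  by congr Rintegral; apply/funext => x; rewrite indicT mul1r.
apply: bmeas_ind.
- by move=> A mA; rewrite int_indic// QE.
- move=> f g bf bg fE gE; rewrite intD// fE gE -intD//; try exact: bmeasM.
  by congr Rintegral; apply/funext => x; rewrite mulrDl.
- move=> c f bf fE; rewrite intZl// fE -intZl//; last exact: bmeasM.
  by congr Rintegral; apply/funext => x; rewrite mulrA.
move=> f bf fL; apply/eqP; rewrite -subr_eq0 -normr_le0.
apply/ler_addgt0Pr => e e0; rewrite add0r.
have [|g [bg gE fg]] := fL (e / 2); first by rewrite divr_gt0.
have bfg := bmeasB bf bg.
rewrite (_ : _ - _ = \int[Q]_x (f x - g x) - \int[P]_x ((f x - g x) * w x)); last first.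
  rewrite intB// gE.
  rewrite [in RHS](_ : (fun x => (f x - g x) * w x) = fun x => f x * w x - g x * w x).
    by rewrite intB; [ring|exact: bmeasM|exact: bmeasM].
  by apply/funext => x; rewrite mulrBl.
rewrite (le_trans (ler_normB _ _))// (splitr e) lerD//.
  exact: int_norm_le.
apply: le_trans (le_normr_Rintegral _ _) _ => //.
  exact: (bmeas_integrable _ (bmeasM bfg bw)).
have -> : e / 2 = \int[P]_x (e / 2 * w x) by rewrite intZl// w1 mulr1.
apply: int_le.
- by apply: bmeas_norm; exact: bmeasM.
- by apply: bmeasM => //; exact: bmeas_cst.
- by move=> x; rewrite normrM (ger0_norm (w0 x)) ler_wpM2r.
Qed.

(** A positive density preserves null sets in both directions, and both standardness
    and the absence of atoms only depend on the null sets. *)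
Lemma density_null (w : T -> R) (A : set T) : has_density w -> (forall x, 0 < w x) ->
  measurable A -> P A = 0%E <-> Q A = 0%E.
Proof.
move=> [bw w0 QE] wgt mA; have bA := @bmeas_indic R _ _ _ mA.
have bAw : bmeas (fun x => \1_A x * w x) by exact: bmeasM.
have QA : Q A = (\int[P]_x (\1_A x * w x))%:E.
  by rewrite -QE// int_indic// fineK ?fin_num_measure.
rewrite QA; split=> [PA0|].
  congr EFin; rewrite -[RHS](int_cst P); apply: int_ae => //; first exact: bmeas_cst.
  exists A; split => // x /= h; apply: contrapT => Ax; apply: h.
  by rewrite indicE memNset// mul0r.
move=> [/(int_eq0_ae bAw)] h.
have {h} [x|N [mN N0 AN]] := h; first by rewrite mulr_ge0// indicE.
apply/eqP; rewrite eq_le measure_ge0 andbT -N0 le_measure ?inE//.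
move=> x Ax; apply: AN => /= /eqP; rewrite indicE mem_set// mul1r.
by rewrite gt_eqF.
Qed.

End weighted_integrals.

Section weighted_spaces.
Context {R : realType} d (T : measurableType d) (P Q : probability T R).
Context (w : T -> R).
Hypotheses (dw : has_density P Q w) (w_gt0 : forall x, 0 < w x).

Lemma standard_weighted : standard P -> standard Q.
Proof.
move=> /standardP[f [g [X [mf mg mX PX gf]]]]; apply/standardP.
exists f, g, X; split=> //.
have mXC := measurableC mX.
have : Q (~` X) = 0%E.
  by apply/(density_null dw w_gt0 mXC); rewrite probability_setC// PX subee.
rewrite probability_setC// => /eqP; by rewrite sube_eq// add0e => /eqP.
Qed.

Lemma atomless_weighted : standard P -> atomless P -> atomless Q.
Proof.
move=> /standardP[f [g [X [mf mg mX PX gf]]]] atP; apply: (diffuse_atomless mf) => r.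
apply/(density_null dw w_gt0); first exact: preimage_measurable.
exact: atomless_diffuse gf r.
Qed.

Lemma int_prod_density (F : T * T -> R) : bmeas F ->
  \int[(Q \x Q)%E]_z F z = \int[(P \x P)%E]_z (F z * (w z.1 * w z.2)).
Proof.
have [bw w0 QE] := dw => bF.
have bw1 : bmeas (fun z : T * T => w z.1) by apply: bmeas_comp bw; exact: measurable_fst.
have bw2 : bmeas (fun z : T * T => w z.2) by apply: bmeas_comp bw; exact: measurable_snd.
rewrite int_prod// QE; last exact: bmeas_int.
rewrite int_prod; last by apply: bmeasM => //; exact: bmeasM.
congr Rintegral; apply/funext => x /=.
rewrite QE; last exact: bmeas_section.
rewrite -intZr; last by apply: bmeasM => //; exact: bmeas_section.
by congr Rintegral; apply/funext => y; ring.
Qed.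

Lemma int_power_density n (F : n.-tuple T -> R) : bmeas F ->
  \int[power_prob Q n]_x F x =
  \int[power_prob P n]_x (F x * \prod_(i < n) w (tnth x i)).
Proof.
have [bw w0 QE] := dw.
have bprod k : bmeas (fun x : k.-tuple T => \prod_(i < k) w (tnth x i)).
  by apply: bmeas_prod => i; apply: bmeas_comp bw; exact: measurable_tnth.
elim: n F => [|n IH] F bF; first by rewrite !int_power0 big_ord0 mulr1.
have bFc : bmeas (fun z : T * n.-tuple T => F (cons_pair z)).
  by apply: (bmeas_comp _ bF); exact: measurable_cons_pair.
rewrite int_powerS// int_powerS; last exact: bmeasM.
rewrite QE; last exact: (bmeas_int _ bFc).
congr Rintegral; apply/funext => x /=.
rewrite IH; last exact: (bmeas_section x bFc).
rewrite -intZr; last exact: (bmeasM (bmeas_section x bFc) (bprod n)).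
congr Rintegral; apply/funext => t.
rewrite big_ord_recl (tnth_nth x)/= -mulrA; congr (_ * _); rewrite mulrC; congr (_ * _).
by apply: eq_bigr => i _; rewrite (tnth_nth x) [in RHS](tnth_nth x).
Qed.

End weighted_spaces.

(** * First-order expansions *)

Section first_order_expansions.
Context {R : realType}.

(** [G e = k (1 + e l) + O(e^2)] uniformly in [|e| <= 1]; carrying the logarithmic
    derivative [l] makes products of expansions add up. *)
Definition expands (X : Type) (G : R -> X -> R) (k l : X -> R) : Prop :=
  [/\ exists M, forall x, `|k x| <= M, exists M, forall x, `|l x| <= M &
      exists C, forall e x, `|e| <= 1 ->
        `|G e x - k x * (1 + e * l x)| <= C * e ^+ 2].

Lemma expands_cst (X : Type) (k : X -> R) : (exists M, forall x, `|k x| <= M) ->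
  expands (fun _ => k) k (fun _ => 0).
Proof.
move=> bk; split=> //; first by exists 0 => x; rewrite normr0.
by exists 0 => e x _; rewrite mulr0 addr0 mulr1 subrr normr0 mul0r.
Qed.

Lemma expands_lin (X : Type) (h : X -> R) : (exists M, forall x, `|h x| <= M) ->
  expands (fun e x => 1 + e * h x) (fun _ => 1) h.
Proof.
move=> bh; split=> //; first by exists 1 => x; rewrite normr1.
by exists 0 => e x _; rewrite mul1r subrr normr0 mul0r.
Qed.

Lemma expands_mul (X : Type) (G H : R -> X -> R) (k l k' l' : X -> R) :
  expands G k l -> expands H k' l' ->
  expands (fun e x => G e x * H e x) (fun x => k x * k' x) (fun x => l x + l' x).
Proof.
move=> [[M1 kM] [M2 lM] [C CG]] [[M1' kM'] [M2' lM'] [C' CH]]; split.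
- by exists (M1 * M1') => x; rewrite normrM ler_pM.
- by exists (M2 + M2') => x; rewrite (le_trans (ler_normD _ _))// lerD.
exists (C * (M1' * (1 + M2') + C') + M1 * (1 + M2) * C' + M1 * M1' * (M2 * M2')).
move=> e x e1; have := CG e x e1; have := CH e x e1.
set g := G e x; set h := H e x; set a := k x * (1 + e * l x).
set b := k' x * (1 + e * l' x) => hb ga.
have ae : `|a| <= M1 * (1 + M2).
  rewrite normrM ler_pM// (le_trans (ler_normD _ _))// normr1 lerD2l normrM.
  by rewrite -[leRHS]mul1r ler_pM.
have be : `|b| <= M1' * (1 + M2').
  rewrite normrM ler_pM// (le_trans (ler_normD _ _))// normr1 lerD2l normrM.
  by rewrite -[leRHS]mul1r ler_pM.
have e2 : e ^+ 2 <= 1 by rewrite -[e ^+ 2]ger0_norm ?sqr_ge0// normrX expr_le1.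
have e20 : 0 <= e ^+ 2 by exact: sqr_ge0.
have C0 : 0 <= C.
  have := CG 1 x; rewrite normr1 => /(_ (lexx _)); rewrite expr1n mulr1.
  exact: le_trans.
have C'0 : 0 <= C'.
  have := CH 1 x; rewrite normr1 => /(_ (lexx _)); rewrite expr1n mulr1.
  exact: le_trans.
have he : `|h| <= M1' * (1 + M2') + C'.
  rewrite -[h](subrK b) addrC (le_trans (ler_normD _ _))// lerD//.
  by rewrite (le_trans hb)// -[leRHS]mulr1 ler_wpM2l.
rewrite (_ : _ - _ = (g - a) * h + a * (h - b) + k x * k' x * (l x * l' x) * e ^+ 2); last first.
  by rewrite /a /b; ring.
rewrite [leRHS]mulrDl (le_trans (ler_normD _ _))// lerD//; last first.
  by rewrite normrM (ger0_norm e20) ler_wpM2r// !normrM !ler_pM// mulr_ge0.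
rewrite [leRHS]mulrDl (le_trans (ler_normD _ _))// lerD// normrM.
  rewrite -[leRHS]mulrA [X in _ <= _ * X]mulrC mulrA ler_pM//.
by rewrite -[leRHS]mulrA; apply: ler_pM.
Qed.

Lemma expands_prod (X I : Type) (s : seq I) (Q : pred I) (G : I -> R -> X -> R)
    (k l : I -> X -> R) :
  (forall i, expands (G i) (k i) (l i)) ->
  expands (fun e x => \prod_(i <- s | Q i) G i e x)
    (fun x => \prod_(i <- s | Q i) k i x) (fun x => \sum_(i <- s | Q i) l i x).
Proof.
move=> EG; elim: s => [|i s IH].
  rewrite (_ : (fun e x => _) = fun _ _ => 1); last first.
    by apply/funext => e; apply/funext => x; rewrite big_nil.
  rewrite (_ : (fun x => _) = fun _ => 1); last by apply/funext => x; rewrite big_nil.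
  rewrite (_ : (fun x => \sum_(i <- _ | _) _) = fun _ => 0); last first.
    by apply/funext => x; rewrite big_nil.
  by apply: expands_cst; exists 1 => _; rewrite normr1.
rewrite (_ : (fun e x => _) = fun e x => (if Q i then G i e x else 1) *
    \prod_(i <- s | Q i) G i e x); last first.
  by apply/funext => e; apply/funext => x; rewrite big_cons; case: (Q i); rewrite ?mul1r.
rewrite (_ : (fun x => \prod_(i <- i :: s | _) _) = fun x => (if Q i then k i x else 1) *
    \prod_(i <- s | Q i) k i x); last first.
  by apply/funext => x; rewrite big_cons; case: (Q i); rewrite ?mul1r.
rewrite (_ : (fun x => \sum_(i <- i :: s | _) _) = fun x => (if Q i then l i x else 0) +
    \sum_(i <- s | Q i) l i x); last first.
  by apply/funext => x; rewrite big_cons; case: (Q i); rewrite ?add0r.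
apply: expands_mul => //; case: (Q i) => //.
by apply: expands_cst; exists 1 => _; rewrite normr1.
Qed.

Lemma expands_int d (T : measurableType d) (P : probability T R)
    (G : R -> T -> R) (k l : T -> R) :
  expands G k l -> (forall e, bmeas (G e)) -> bmeas k -> bmeas l ->
  \int[P]_x k x != 0 ->
  expands (fun e (_ : unit) => \int[P]_x G e x) (fun=> \int[P]_x k x)
    (fun=> (\int[P]_x (k x * l x)) / \int[P]_x k x).
Proof.
move=> [_ _ [C CG]] bG bk bl k0; split.
- by exists `|\int[P]_x k x| => _.
- by exists `|(\int[P]_x (k x * l x)) / \int[P]_x k x| => _.
have bkl := bmeasM bk bl.
exists C => e _ e1; rewrite mulrDr mulr1 mulrCA (mulrC (\int[P]_x k x)) divfK//.
have bekl : bmeas (fun x => e * (k x * l x)) by apply: bmeasM => //; exact: bmeas_cst.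
rewrite -(intZl _ _ bkl) -intD// -intB//; last exact: bmeasD.
apply: int_norm_le; first by apply: bmeasB => //; exact: bmeasD.
by move=> x; have := CG e x e1; rewrite mulrDr mulr1 mulrCA.
Qed.

Lemma expands_exp (G : R -> unit -> R) (k l : R) n :
  expands G (fun=> k) (fun=> l) ->
  expands (fun e x => G e x ^+ n) (fun=> k ^+ n) (fun=> l *+ n).
Proof.
move=> EG; have := @expands_prod _ _ (index_enum 'I_n) xpredT (fun _ => G) _ _ (fun=> EG).
rewrite (_ : (fun e x => \prod_(_ <- _ | _) _) = fun e x => G e x ^+ n); last first.
  by apply/funext => e; apply/funext => x; rewrite prodr_const card_ord.
rewrite (_ : (fun x => \prod_(_ <- _ | _) _) = fun=> k ^+ n); last first.
  by apply/funext => x; rewrite prodr_const card_ord.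
rewrite (_ : (fun x => \sum_(_ <- _ | _) _) = fun=> l *+ n)//.
by apply/funext => x; rewrite sumr_const card_ord.
Qed.

(** Both signs of [e] are allowed, so an inequality that is tight at [e = 0]
    forces the first-order terms to agree. *)
Lemma expands_le_eq (G H : R -> unit -> R) (k l l' d : R) :
  expands G (fun=> k) (fun=> l) -> expands H (fun=> k) (fun=> l') -> 0 < d ->
  (forall e, `|e| <= d -> H e tt <= G e tt) -> k * l = k * l'.
Proof.
move=> [_ _ [C CG]] [_ _ [C' CH]] d0 HG.
pose c := k * l - k * l'; pose D := `|C| + `|C'|.
have key e : `|e| <= d -> `|e| <= 1 -> - D * e ^+ 2 <= e * c.
  move=> ed e1; have := CG e tt e1; have := CH e tt e1; have := HG e ed.
  rewrite !ler_norml => h /andP[h1 h2] /andP[h3 h4].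
  have : C * e ^+ 2 + C' * e ^+ 2 <= D * e ^+ 2.
    by rewrite -mulrDl ler_wpM2r ?sqr_ge0// /D lerD// ler_norm.
  by rewrite /c; nra.
have D0 : 0 <= D by rewrite addr_ge0.
suff : `|c| <= 0 by rewrite normr_le0 subr_eq0 => /eqP.
apply/ler_addgt0Pr => r r0; rewrite add0r.
pose e : R := Num.min (Num.min d 1) (r / (D + 1)).
have e0 : 0 < e by rewrite !lt_min d0 ltr01 divr_gt0// ltr_wpDl.
have ed : e <= d by rewrite !ge_min lexx.
have e1 : e <= 1 by rewrite !ge_min lexx orbT.
have er : e * (D + 1) <= r by rewrite -ler_pdivlMr ?ltr_wpDl// ge_min lexx orbT.
have := key e; have := key (- e); rewrite normrN gtr0_norm// sqrrN => /(_ ed e1) h1 /(_ ed e1) h2.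
have Der : D * e <= r by nra.
rewrite ler_norml; apply/andP; split.
  rewrite -(ler_pM2l e0); apply: le_trans h2; rewrite expr2; nra.
rewrite -(ler_pM2l e0); move: h1; rewrite expr2; nra.
Qed.

End first_order_expansions.

(** * The first-order condition for homomorphism densities *)

Section densities.
Context {R : realType} d (T : measurableType d) (P : probability T R).
Variables (F : sgraph) (K : T -> T -> R).

Definition vpoint (x : #|F|.-tuple T) (u : F) : T := tnth x (enum_rank u).

Definition edge_prod (x : #|F|.-tuple T) : R :=
  \prod_(e in edges F) K (vpoint x e.1) (vpoint x e.2).

(** The moment of [a] at the vertex [u], that is, the integral of [a] against
    the density of copies of [F] rooted at [u]. *)
Definition root_moment (u : F) (a : T -> R) : R :=
  \int[power_prob P #|F|]_x (edge_prod x * a (vpoint x u)).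

Definition deg_moment (a : T -> R) : R := \int[(P \x P)%E]_z (K z.1 z.2 * a z.1).

Hypothesis bK : bmeas (fun z : T * T => K z.1 z.2).

Lemma bmeas_vpoint (a : T -> R) u : bmeas a -> bmeas (fun x => a (vpoint x u)).
Proof. by move=> ba; apply: bmeas_comp ba; exact: measurable_tnth. Qed.

Lemma bmeas_edge e : bmeas (fun x => K (vpoint x e.1) (vpoint x e.2)).
Proof.
apply: (bmeas_comp (phi := fun x => (vpoint x e.1, vpoint x e.2)) _ bK).
by apply: measurable_fun_pair; exact: measurable_tnth.
Qed.

Lemma bmeas_edge_prod : bmeas edge_prod.
Proof. by apply: bmeas_prod => e; exact: bmeas_edge. Qed.

Lemma bmeas_left (a : T -> R) : bmeas a -> bmeas (fun z : T * T => a z.1).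
Proof. by move=> ba; apply: bmeas_comp ba; exact: measurable_fst. Qed.

Lemma bmeas_right (a : T -> R) : bmeas a -> bmeas (fun z : T * T => a z.2).
Proof. by move=> ba; apply: bmeas_comp ba; exact: measurable_snd. Qed.

Lemma deg_momentE (a : T -> R) : bmeas a ->
  deg_moment a = \int[P]_x (a x * \int[P]_y K x y).
Proof.
move=> ba; rewrite /deg_moment int_prod; last by apply: bmeasM => //; exact: bmeas_left.
congr Rintegral; apply/funext => x /=.
by rewrite intZr 1?mulrC//; exact: (bmeas_section x bK).
Qed.

Lemma deg_momentC (a : T -> R) : kernel_symmetric K -> bmeas a ->
  \int[(P \x P)%E]_z (K z.1 z.2 * a z.2) = deg_moment a.
Proof.
move=> sK ba; rewrite int_prod2; last by apply: bmeasM => //; exact: bmeas_right.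
rewrite /deg_moment int_prod; last by apply: bmeasM => //; exact: bmeas_left.
by congr Rintegral; apply/funext => x; congr Rintegral; apply/funext => y /=; rewrite sK.
Qed.

End densities.

Section first_order_condition.
Context {R : realType} (F : sgraph) (good_F : sidorenko_good R F).
Context d (T : measurableType d) (P : probability T R) (K : T -> T -> R).
Hypotheses (stdP : standard P) (atP : atomless P) (dnnK : bounded_dnn P K).
Hypotheses (p_gt0 : 0 < norm1 P K)
  (tight : hom_density P F K = norm1 P K ^+ edge_count F).

Let bK : bmeas (fun z : T * T => K z.1 z.2).
Proof. by have [mK _ [M KM] _ _] := dnnK; split=> //; exists M => z. Qed.

(** For small [e], reweight the space by the density [1 + e a] and replace [K] by the
    kernel [(1 + e b(x)) K(x,y) (1 + e b(y))], which is again doubly nonnegative. The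
    inequality for this kernel is an equality at [e = 0]; compare first-order terms. *)
Lemma first_order (a b : T -> R) : bmeas a -> bmeas b -> \int[P]_x a x = 0 ->
  norm1 P K * (\sum_(e in edges F) (root_moment P K e.1 b + root_moment P K e.2 b) +
     \sum_(u : F) root_moment P K u a) =
  hom_density P F K * (2 * (deg_moment P K a + deg_moment P K b)) *+ edge_count F.
Proof.
move=> ba bb Ia0.
have [mK sK bdK K0 psdK] := dnnK.
have [_ [Ma aM]] := ba; have [_ [Mb bM]] := bb.
pose w e x : R := 1 + e * a x; pose f e x : R := 1 + e * b x.
have bw e : bmeas (w e).
  by apply: bmeasD; [|apply: bmeasM => //]; exact: bmeas_cst.
have bf e : bmeas (f e).
  by apply: bmeasD; [|apply: bmeasM => //]; exact: bmeas_cst.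
pose Ke e x y : R := f e x * K x y * f e y.
have bKe e : bmeas (fun z : T * T => Ke e z.1 z.2).
  by apply: bmeasM; [apply: bmeasM => //; exact: bmeas_left|exact: bmeas_right].
pose G e (x : #|F|.-tuple T) : R :=
  (\prod_(i in edges F) Ke e (vpoint x i.1) (vpoint x i.2)) *
  \prod_(u : F) w e (vpoint x u).
pose N e (z : T * T) : R := Ke e z.1 z.2 * (w e z.1 * w e z.2).
have bG e : bmeas (G e).
  apply: bmeasM.
    by apply: bmeas_prod => i; exact: bmeas_edge.
  by apply: bmeas_prod => i; exact: bmeas_vpoint.
have bN e : bmeas (N e).
  by apply: bmeasM => //; apply: bmeasM; [exact: bmeas_left|exact: bmeas_right].
pose lG (x : #|F|.-tuple T) : R :=
  (\sum_(i in edges F) (b (vpoint x i.1) + b (vpoint x i.2))) +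
  \sum_(u : F) a (vpoint x u).
pose lN (z : T * T) : R := (b z.1 + b z.2) + (a z.1 + a z.2).
have blG : bmeas lG.
  apply: bmeasD; last by apply: bmeas_sum => u; exact: bmeas_vpoint.
  by apply: bmeas_sum => i; apply: bmeasD; exact: bmeas_vpoint.
have blN : bmeas lN.
  by apply: bmeasD; apply: bmeasD; [exact: bmeas_left|exact: bmeas_right|
    exact: bmeas_left|exact: bmeas_right].
have bE : bmeas (@edge_prod R _ T F K) by exact: bmeas_edge_prod.
have homE : hom_density P F K = \int[power_prob P #|F|]_x edge_prod K x by [].
have hom_gt0 : 0 < hom_density P F K by rewrite tight exprn_gt0.
have exG : expands (fun e (_ : unit) => \int[power_prob P #|F|]_x G e x)
    (fun=> hom_density P F K)
    (fun=> (\int[power_prob P #|F|]_x (edge_prod K x * lG x)) / hom_density P F K).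
  rewrite homE; apply: expands_int => //; last by rewrite -homE gt_eqF.
  rewrite (_ : edge_prod K = fun x => 
      (\prod_(i in edges F) (1 * K (vpoint x i.1) (vpoint x i.2) * 1)) *
      \prod_(u : F) 1); last first.
    apply/funext => x; rewrite [\prod_(u : F) 1]big1// mulr1.
    by apply: eq_bigr => i _; rewrite mul1r mulr1.
  rewrite (_ : lG = fun x => 
      (\sum_(i in edges F) (b (vpoint x i.1) + 0 + b (vpoint x i.2))) +
      \sum_(u : F) a (vpoint x u)); last first.
    by apply/funext => x; congr (_ + _); apply: eq_bigr => i _; rewrite addr0.
  apply: expands_mul.
    apply: expands_prod => i.
    apply: expands_mul; [apply: expands_mul|].
    - by apply: expands_lin; exists Mb => x.
    - by apply: expands_cst; have [M KM] := bdK; exists M => x.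
    - by apply: expands_lin; exists Mb => x.
  by apply: expands_prod => u; apply: expands_lin; exists Ma => x.
have exN : expands (fun e (_ : unit) => \int[(P \x P)%E]_z N e z)
    (fun=> norm1 P K)
    (fun=> (\int[(P \x P)%E]_z (K z.1 z.2 * lN z)) / norm1 P K).
  apply: expands_int => //; last by rewrite -/(norm1 P K) gt_eqF.
  rewrite (_ : (fun z => K z.1 z.2) = fun z => 1 * K z.1 z.2 * 1 * (1 * 1)); last first.
    by apply/funext => z; rewrite mul1r !mulr1.
  rewrite (_ : lN = fun z => b z.1 + 0 + b z.2 + (a z.1 + a z.2)); last first.
    by apply/funext => z; rewrite addr0.
  apply: expands_mul; apply: expands_mul; [apply: expands_mul|..].
  - by apply: expands_lin; exists Mb => x.
  - by apply: expands_cst; have [M KM] := bdK; exists M => x.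
  - by apply: expands_lin; exists Mb => x.
  - by apply: expands_lin; exists Ma => x.
  - by apply: expands_lin; exists Ma => x.
have exNe := expands_exp (edge_count F) exN; rewrite -tight in exNe.
have Ma0 : 0 <= Ma by exact: le_trans (aM point).
have Mb0 : 0 <= Mb by exact: le_trans (bM point).
(* Small enough for [1 + e a] and [1 + e b] to be at least 1/2. *)
pose dl : R := (2 * (Ma + Mb + 1))^-1.
have dl0 : 0 < dl by rewrite invr_gt0 mulr_gt0// ltr_wpDl// addr_ge0.
have small e (h : T -> R) x : `|e| <= dl -> `|h x| <= Ma + Mb -> 0 < 1 + e * h x.
  move=> edl hM; have : `|e * h x| <= 1 / 2.
    rewrite normrM; apply: (@le_trans _ _ (dl * (Ma + Mb + 1))).
      by rewrite ler_pM// (le_trans hM)// lerDl.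
    have S0 : Ma + Mb + 1 != 0 by rewrite gt_eqF// ltr_wpDl// addr_ge0.
    by rewrite /dl invfM -mulrA mulVf// mulr1 div1r.
  by rewrite ler_norml => /andP[h1 h2]; lra.
have le_GN e : `|e| <= dl ->
    (\int[(P \x P)%E]_z N e z) ^+ edge_count F <= \int[power_prob P #|F|]_x G e x.
  move=> edl.
  have w0 x : 0 < w e x by apply: small => //; rewrite (le_trans (aM x))// lerDl.
  have f0 x : 0 < f e x by apply: small => //; rewrite (le_trans (bM x))// lerDr.
  have Iw : \int[P]_x w e x = 1.
    rewrite /w intD//; [|exact: bmeas_cst|by apply: bmeasM => //; exact: bmeas_cst].
    by rewrite int_cst intZl// Ia0 mulr0 addr0.
  have [Q QE] := weighted_exists (bw e) (fun x => ltW (w0 x)) Iw.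
  have dQ := has_densityI (bw e) (fun x => ltW (w0 x)) QE.
  have dnnKe : bounded_dnn Q (Ke e).
    have [mKe [M KeM]] := bKe e; split.
    - by [].
    - by move=> x y; rewrite /Ke sK; ring.
    - by exists M => x y; exact: (KeM (x, y)).
    - by move=> x y; rewrite /Ke !mulr_ge0// ltW.
    - move=> g mg bdg; have bg : bmeas g by split.
      rewrite (int_prod_density dQ); last first.
        by apply: bmeasM; [apply: bmeasM => //; exact: bmeas_left|exact: bmeas_right].
      have bgfw : bmeas (fun x => g x * f e x * w e x) by apply: bmeasM => //; exact: bmeasM.
      have [mgfw bdgfw] := bgfw.
      have := psdK _ mgfw bdgfw; congr (0 <= _); congr Rintegral; apply/funext => z.
      by rewrite /Ke; ring.
  have := good_F (standard_weighted dQ w0 stdP) (atomless_weighted dQ w0 stdP atP) dnnKe.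
  rewrite /norm1 (int_prod_density dQ)//; move/le_trans; apply.
  rewrite /hom_density (int_power_density dQ); last by apply: bmeas_prod => i; exact: bmeas_edge.
  rewrite le_eqVlt; apply/orP; left; apply/eqP; congr Rintegral; apply/funext => x.
  congr (_ * _); rewrite (reindex (@enum_rank F))//; exact/onW_bij/enum_rank_bij.
have := expands_le_eq exG exNe dl0 le_GN.
rewrite mulrCA divff ?gt_eqF// mulr1.
have -> : \int[(P \x P)%E]_z (K z.1 z.2 * lN z) = 2 * (deg_moment P K a + deg_moment P K b).
  transitivity (\int[(P \x P)%E]_z ((K z.1 z.2 * b z.1 + K z.1 z.2 * b z.2) +
      (K z.1 z.2 * a z.1 + K z.1 z.2 * a z.2))).
    by congr Rintegral; apply/funext => z; rewrite /lN; ring.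
  have bKl c : bmeas c -> bmeas (fun z : T * T => K z.1 z.2 * c z.1).
    by move=> bc; apply: bmeasM => //; exact: bmeas_left.
  have bKr c : bmeas c -> bmeas (fun z : T * T => K z.1 z.2 * c z.2).
    by move=> bc; apply: bmeasM => //; exact: bmeas_right.
  rewrite intD; [|exact: (bmeasD (bKl _ bb) (bKr _ bb))|exact: (bmeasD (bKl _ ba) (bKr _ ba))].
  rewrite intD; [|exact: bKl|exact: bKr].
  rewrite intD; [|exact: bKl|exact: bKr].
  by rewrite !deg_momentC// -/(deg_moment P K a) -/(deg_moment P K b); ring.
have -> : \int[power_prob P #|F|]_x (edge_prod K x * lG x) =
    \sum_(e in edges F) (root_moment P K e.1 b + root_moment P K e.2 b) +
     \sum_(u : F) root_moment P K u a.
  have bEv c u : bmeas c -> bmeas (fun x : #|F|.-tuple T => edge_prod K x * c (vpoint x u)).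
    by move=> bc; apply: bmeasM => //; exact: bmeas_vpoint.
  transitivity (\int[power_prob P #|F|]_x (
     (\sum_(i in edges F) (edge_prod K x * b (vpoint x i.1) + edge_prod K x * b (vpoint x i.2)))
     + \sum_(u : F) edge_prod K x * a (vpoint x u))).
    congr Rintegral; apply/funext => x; rewrite /lG mulrDr !mulr_sumr; congr (_ + _).
    by apply: eq_bigr => i _; rewrite mulrDr.
  have bEs i : bmeas (fun x : #|F|.-tuple T =>
      edge_prod K x * b (vpoint x i.1) + edge_prod K x * b (vpoint x i.2)).
    by apply: bmeasD; exact: bEv.
  rewrite intD; [|exact: bmeas_sum|by apply: bmeas_sum => u; exact: bEv].
  rewrite int_sum// int_sum; last by move=> u; exact: bEv.
  by congr (_ + _); apply: eq_bigr => i _; rewrite intD//; exact: bEv.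
move=> ->; rewrite mulrCA -[RHS]mulrnAr; congr (_ * _).
by rewrite mulrnAr mulrC divfK ?gt_eqF.
Qed.

End first_order_condition.

(** * The Schur product theorem for matrices *)

Section schur_product.
Context {R : realType}.

Definition quad (n : nat) (A : nat -> nat -> R) (c : nat -> R) : R :=
  \sum_(i < n) \sum_(j < n) c i * c j * A i j.

Definition shiftc (c0 : R) (c : nat -> R) (i : nat) : R :=
  if i is j.+1 then c j else c0.

Lemma quadS n A c0 c : (forall i j, A i j = A j i) ->
  quad n.+1 A (shiftc c0 c) = c0 ^+ 2 * A 0%N 0%N +
    2 * c0 * (\sum_(i < n) c i * A 0%N i.+1) + quad n (fun i j => A i.+1 j.+1) c.
Proof.
move=> sA; rewrite /quad big_ord_recl big_ord_recl /=.
under [X in _ + X = _]eq_bigr => i _ do rewrite big_ord_recl /=.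
rewrite big_split/=.
have -> : \sum_(i < n) c0 * c i * A 0%N (bump 0 i) = c0 * \sum_(i < n) c i * A 0%N i.+1.
  by rewrite mulr_sumr; apply: eq_bigr => i _; rewrite -mulrA.
have -> : \sum_(i < n) c i * c0 * A (bump 0 i) 0%N = c0 * \sum_(i < n) c i * A 0%N i.+1.
  by rewrite mulr_sumr; apply: eq_bigr => i _; rewrite sA mulrAC mulrC.
rewrite addrA; congr (_ + _).
set S := \sum_(i < n) _; move: S => S; ring.
Qed.

(** The finite-dimensional Schur product theorem, by clearing one row and column
    at a time (symmetric Gaussian elimination); the convention [x / 0 = 0]
    covers the degenerate pivot. *)
Lemma schur_sum_ge0 n (A B : nat -> nat -> R) :
  (forall i j, A i j = A j i) -> (forall i j, B i j = B j i) ->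
  (forall c, 0 <= quad n A c) -> (forall c, 0 <= quad n B c) ->
  0 <= \sum_(i < n) \sum_(j < n) A i j * B i j.
Proof.
elim: n A B => [|n IH] A B sA sB psA psB; first by rewrite big_ord0.
pose p := A 0%N 0%N.
have quad_row c0 (c : nat -> R) : 0 <= c0 ^+ 2 * p + 2 * c0 * (\sum_(i < n) c i * A 0%N i.+1) +
    quad n (fun i j => A i.+1 j.+1) c.
  by rewrite -quadS.
have p0 i : (i < n)%N -> p = 0 -> A 0%N i.+1 = 0.
  move=> ni p_eq0.
  pose c (k : nat) : R := (k == i)%:R.
  have cs : \sum_(k < n) c k * A 0%N k.+1 = A 0%N i.+1.
    rewrite (bigD1 (Ordinal ni))//= /c eqxx mul1r big1 ?addr0// => k ki.
    by rewrite (_ : (k : nat) == i = false) ?mul0r//; apply/negbTE.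
  have h t : 0 <= 2 * t * A 0%N i.+1 + quad n (fun i j => A i.+1 j.+1) c.
    by have := quad_row t c; rewrite cs p_eq0 mulr0 add0r.
  set q := quad _ _ _ in h; apply/eqP; apply: contrapT => /negP x0.
  (* A nonzero entry next to a zero pivot would make the form negative here. *)
  have := h (- (q + 1) / (2 * A 0%N i.+1)).
  rewrite (_ : 2 * _ * _ = - (q + 1)); last by field; exact: x0.
  by move=> ?; lra.
pose A' i j : R := A i.+1 j.+1 - A 0%N i.+1 * A 0%N j.+1 / p.
have psA' (c : nat -> R) : 0 <= quad n A' c.
  pose s := \sum_(i < n) c i * A 0%N i.+1.
  have -> : quad n A' c = quad n (fun i j => A i.+1 j.+1) c - s ^+ 2 / p.
    rewrite expr2 /s mulr_suml mulr_suml -sumrB; apply: eq_bigr => i _.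
    rewrite -mulrA mulr_suml mulr_sumr -sumrB.
    by apply: eq_bigr => j _; rewrite /A'; ring.
  have := quad_row (- s / p) c; rewrite -/s.
  have [pe0|pn0] := eqVneq p 0.
    rewrite pe0 invr0 !mulr0 !mul0r add0r subr0.
    by rewrite add0r.
  by congr (0 <= _); field.
have -> : \sum_(i < n.+1) \sum_(j < n.+1) A i j * B i j =
   quad n.+1 B (shiftc p (fun i => A 0%N i.+1)) / p +
   \sum_(i < n) \sum_(j < n) A' i j * B i.+1 j.+1.
  rewrite quadS// big_ord_recl big_ord_recl /=.
  under [X in _ + X = _]eq_bigr => i _ do rewrite big_ord_recl /=.
  rewrite big_split/=.
  have E1 : \sum_(i < n) A 0%N (bump 0 i) * B 0%N (bump 0 i) =
      \sum_(i < n) A 0%N i.+1 * B 0%N i.+1 by [].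
  have E2 : \sum_(i < n) A (bump 0 i) 0%N * B (bump 0 i) 0%N = \sum_(i < n) A 0%N i.+1 * B 0%N i.+1.
    by apply: eq_bigr => i _; rewrite sA sB.
  rewrite E1 E2; set s := \sum_(i < n) A 0%N i.+1 * B 0%N i.+1.
  have -> : \sum_(i < n) \sum_(j < n) A' i j * B i.+1 j.+1 =
      \sum_(i < n) \sum_(j < n) A i.+1 j.+1 * B i.+1 j.+1 -
      quad n (fun i j => B i.+1 j.+1) (fun i => A 0%N i.+1) / p.
    rewrite /quad mulr_suml -sumrB; apply: eq_bigr => i _.
    by rewrite mulr_suml -sumrB; apply: eq_bigr => j _; rewrite /A'; ring.
  have -> : \sum_(i < n) \sum_(j < n) A (bump 0 i) (bump 0 j) * B (bump 0 i) (bump 0 j) =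
     \sum_(i < n) \sum_(j < n) A i.+1 j.+1 * B i.+1 j.+1 by [].
  rewrite -/p; have [pe0|pn0] := eqVneq p 0.
    rewrite pe0 invr0 !mulr0 (_ : s = 0) ?mul0r ?subr0 ?add0r ?addr0//.
    by rewrite /s big1// => i _; rewrite p0// mul0r.
  by field.
apply: addr_ge0.
  apply: divr_ge0; first exact: psB.
  have := quad_row 1 (fun=> 0); rewrite expr1n mul1r.
  rewrite big1 ?mulr0 ?addr0; last by move=> i _; rewrite mul0r.
  by rewrite /quad big1 ?addr0// => i _; rewrite big1// => j _; rewrite !mul0r.
apply: (IH A' (fun i j => B i.+1 j.+1)) => //.
- by move=> i j; rewrite /A' sA [A 0%N i.+1 * _]mulrC.
- move=> c; have := psB (shiftc 0 c); rewrite quadS// expr2 !mul0r mulr0 mul0r.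
  by rewrite !add0r.
Qed.

End schur_product.

(** * Approximation by functions of finite rank *)

Lemma prob_bigcup_approx {R : realType} d (T : measurableType d)
    (P : probability T R) (F : (set T)^nat) (e : R) :
  (forall k, measurable (F k)) -> trivIset [set: nat] F -> 0 < e ->
  exists n, fine (P (\bigcup_k F k)) - \sum_(i < n) fine (P (F i)) <= e.
Proof.
move=> mF tF e0.
have mU : measurable (\bigcup_k F k) by exact: bigcupT_measurable.
have : (\sum_(0 <= i < n) P (F i))%E @[n --> \oo] --> P (\bigcup_k F k).
  exact: measure_semi_sigma_additive.
rewrite -[X in _ --> X]fineK ?fin_num_measure// => /fine_cvgP[_].
move/cvgrPdist_le => /(_ e e0)[n _ /(_ n (leqnn n))] h; exists n.
apply: le_trans h; apply: le_trans (ler_norm _); rewrite lerD2l lerN2/=.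
rewrite big_mkord [X in fine X](_ : _ = (\sum_(i < n) fine (P (F i)))%:E)//.
by rewrite -sumEFin; apply: eq_bigr => i _; rewrite fineK ?fin_num_measure.
Qed.

Section finite_rank.
Context {R : realType} d1 d2 (T1 : measurableType d1) (T2 : measurableType d2).
Context (P : probability T1 R) (Q : probability T2 R).

Definition finite_rank (g : T1 * T2 -> R) : Prop :=
  exists (n : nat) (a : nat -> T1 -> R) (b : nat -> T2 -> R),
    [/\ forall i, bmeas (a i), forall i, bmeas (b i) &
        forall z, g z = \sum_(i < n) a i z.1 * b i z.2].

Lemma bmeas_tensor (a : T1 -> R) (b : T2 -> R) : bmeas a -> bmeas b ->
  bmeas (fun z : T1 * T2 => a z.1 * b z.2).
Proof.
move=> ba bb; apply: bmeasM.
  by apply: bmeas_comp ba; exact: measurable_fst.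
by apply: bmeas_comp bb; exact: measurable_snd.
Qed.

Lemma finite_rank_bmeas g : finite_rank g -> bmeas g.
Proof.
move=> [n [a [b [ba bb gE]]]].
rewrite (_ : g = fun z => \sum_(i < n) a i z.1 * b i z.2); last exact/funext.
by apply: bmeas_sum => i; exact: bmeas_tensor.
Qed.

Lemma finite_rank_cons (a : T1 -> R) (b : T2 -> R) g :
  bmeas a -> bmeas b -> finite_rank g ->
  finite_rank (fun z => a z.1 * b z.2 + g z).
Proof.
move=> ba bb [n [a' [b' [ba' bb' gE]]]].
exists n.+1, (fun i => if i is j.+1 then a' j else a),
  (fun i => if i is j.+1 then b' j else b); split.
- by case.
- by case.
- by move=> z; rewrite big_ord_recl/= gE.
Qed.

Lemma finite_rankD f g : finite_rank f -> finite_rank g ->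
  finite_rank (fun z => f z + g z).
Proof.
move=> [n [a [b [ba bb fE]]]] rg; rewrite (funext fE) {f fE}.
elim: n a b ba bb => [|n IH] a b ba bb.
  by under eq_fun do rewrite big_ord0 add0r.
under eq_fun do rewrite big_ord_recl/= -addrA.
apply: finite_rank_cons => //.
exact: (IH (fun i => a i.+1) (fun i => b i.+1)).
Qed.

Lemma finite_rankZ c f : finite_rank f -> finite_rank (fun z => c * f z).
Proof.
move=> [n [a [b [ba bb fE]]]]; exists n, (fun i x => c * a i x), b; split=> //.
  by move=> i; apply: bmeasM => //; exact: bmeas_cst.
by move=> z; rewrite fE mulr_sumr; apply: eq_bigr => i _; rewrite mulrA.
Qed.

(** Mean approximation suffices because the quadratic form of a bounded kernel is
    continuous for the L1 norm. *)
Definition L1_approx (f : T1 * T2 -> R) : Prop := forall e, 0 < e ->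
  exists2 g, finite_rank g & \int[(P \x Q)%E]_z `|f z - g z| <= e.

Lemma L1_approxD f g : bmeas f -> bmeas g -> L1_approx f -> L1_approx g ->
  L1_approx (fun z => f z + g z).
Proof.
move=> bf bg Af Ag e e0.
have [|f' rf fe] := Af (e / 2); first by rewrite divr_gt0.
have [|g' rg ge] := Ag (e / 2); first by rewrite divr_gt0.
exists (fun z => f' z + g' z); first exact: finite_rankD.
have bf' := finite_rank_bmeas rf; have bg' := finite_rank_bmeas rg.
have bff := bmeas_norm (bmeasB bf bf'); have bgg := bmeas_norm (bmeasB bg bg').
rewrite (splitr e); apply: le_trans (lerD fe ge); rewrite -intD//.
apply: int_le; [|exact: bmeasD|].
  by apply: bmeas_norm; apply: bmeasB; exact: bmeasD.
by move=> z; rewrite opprD addrACA ler_normD.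
Qed.

Lemma L1_approxZ c f : bmeas f -> L1_approx f -> L1_approx (fun z => c * f z).
Proof.
move=> bf Af e e0.
have c1 : 0 < `|c| + 1 by rewrite ltr_wpDl.
have [|g rg ge] := Af (e / (`|c| + 1)); first by rewrite divr_gt0.
exists (fun z => c * g z); first exact: finite_rankZ.
have bfg := bmeas_norm (bmeasB bf (finite_rank_bmeas rg)).
rewrite (_ : (fun z => _) = fun z => `|c| * `|f z - g z|); last first.
  by apply/funext => z; rewrite -mulrBr normrM.
rewrite intZl//; apply: (@le_trans _ _ ((`|c| + 1) * (e / (`|c| + 1)))).
  by rewrite ler_pM ?int_ge0 ?lerDl.
by rewrite mulrC divfK// gt_eqF.
Qed.

Lemma L1_approx_lim f : bmeas f ->
  (forall e, 0 < e -> exists g, [/\ bmeas g, L1_approx g &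
    \int[(P \x Q)%E]_z `|f z - g z| <= e]) -> L1_approx f.
Proof.
move=> bf Lf e e0.
have [|g [bg Ag fg]] := Lf (e / 2); first by rewrite divr_gt0.
have [|h rh gh] := Ag (e / 2); first by rewrite divr_gt0.
exists h => //; have bh := finite_rank_bmeas rh.
have b1 := bmeas_norm (bmeasB bf bg); have b2 := bmeas_norm (bmeasB bg bh).
rewrite (splitr e); apply: le_trans (lerD fg gh); rewrite -intD//.
apply: int_le; [exact/bmeas_norm/bmeasB|exact: bmeasD|].
by move=> z; rewrite -[f z - h z](subrKA (g z)) ler_normD.
Qed.

Lemma L1_approx_rect A B : measurable A -> measurable B -> L1_approx \1_(A `*` B).
Proof.
move=> mA mB e e0; exists (\1_(A `*` B)); last first.
  under eq_fun do rewrite subrr normr0.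
  by rewrite int_cst ltW.
exists 1%N, (fun=> \1_A), (fun=> \1_B); split; [by move=> _; exact: bmeas_indic|
  by move=> _; exact: bmeas_indic|].
move=> [x y]; rewrite big_ord1 /= !indicE -natrM mulnb; congr (nat_of_bool _)%:R.
by apply/idP/andP; rewrite !inE.
Qed.

(** The sets with this property form a Dynkin system containing the rectangles. *)
Lemma L1_approx_indic A : measurable A -> L1_approx \1_A.
Proof.
have L1T : L1_approx \1_setT by rewrite -setXTT; exact: L1_approx_rect.
rewrite [X in X A -> _]measurable_prod_measurableType; move: A.
apply: dynkin_induction => //.
- exact: measurable_prod_measurableType.
- move=> _ _ [A1 mA1 [A2 mA2 <-]] [B1 mB1 [B2 mB2 <-]].
  exists (A1 `&` B1); first exact: measurableI.
  by exists (A2 `&` B2); [exact: measurableI|rewrite setXI].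
- by move=> _ [A mA [B mB <-]]; exact: L1_approx_rect.
- move=> S mS AS; rewrite (_ : \1_(~` S) = fun z => \1_setT z + -1 * \1_S z).
    apply: L1_approxD => //; last by apply: L1_approxZ => //; exact: bmeas_indic.
      exact: bmeas_indic.
    by apply: bmeasM; [exact: bmeas_cst|exact: bmeas_indic].
  by apply/funext => z; rewrite !indicE in_setC in_setT; case: (z \in S) => /=; ring.
move=> F mF tF AF; have mU : measurable (\bigcup_k F k) by exact: bigcupT_measurable.
apply: L1_approx_lim; first exact: bmeas_indic.
move=> e e0.
pose s n (z : T1 * T2) : R := \sum_(i < n) \1_(F i) z.
have bs n : bmeas (s n) by apply: bmeas_sum => i; exact: bmeas_indic.
have As n : L1_approx (s n).
  elim: n => [|n IH].
    rewrite (_ : s 0%N = fun z => 0 * \1_setT z).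
      by apply: L1_approxZ => //; exact: bmeas_indic.
    by apply/funext => z; rewrite /s big_ord0 mul0r.
  rewrite (_ : s n.+1 = fun z => s n z + \1_(F n) z).
    by apply: L1_approxD => //; exact: bmeas_indic.
  by apply/funext => z; rewrite /s big_ord_recr.
have s_le n z : s n z <= \1_(\bigcup_k F k) z.
  have [[k _ Fkz]|nF] := pselect ((\bigcup_k F k) z).
    rewrite indicE mem_set; last by exists k.
    have [kn|nk] := ltnP k n.
      rewrite /s; under eq_bigr => i _ do rewrite -[\1_(F i) z]mul1r.
      by rewrite (sum_indic (fun=> 1) tF kn Fkz).
    rewrite /s big1// => i _; rewrite indicE memNset// => Fiz.
    have ik : (i : nat) = k by apply: (tF i k) => //; exists z.
    by move: (ltn_ord i); rewrite ik ltnNge nk.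
  rewrite /s big1 ?indicE// => i _; rewrite indicE memNset// => Fiz.
  by apply: nF; exists i.
have [n ne] := prob_bigcup_approx (P \x Q)%E mF tF e0.
exists (s n); split=> //.
rewrite (_ : (fun z => _) = fun z => \1_(\bigcup_k F k) z - s n z); last first.
  by apply/funext => z; rewrite ger0_norm// subr_ge0.
rewrite intB//; last exact: bmeas_indic.
rewrite int_indic// int_sum; last by move=> i; exact: bmeas_indic.
under eq_bigr => i _ do rewrite int_indic//.
exact: ne.
Qed.

Lemma L1_approx_bmeas f : bmeas f -> L1_approx f.
Proof.
apply: bmeas_ind; [exact: L1_approx_indic|exact: L1_approxD|by move=> c g; exact: L1_approxZ|].
move=> f' bf fL; apply: L1_approx_lim => // e e0.
have [g [bg Ag fg]] := fL _ e0; exists g; split=> //.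
rewrite -[leRHS](int_cst (P \x Q)%E); apply: int_le => //; [|exact: bmeas_cst].
exact/bmeas_norm/bmeasB.
Qed.

End finite_rank.

(** * Tensor products of kernels *)

Section bilinear_forms.
Context {R : realType} d (T : measurableType d) (P : probability T R).
Variable K : T -> T -> R.
Hypothesis bK : bmeas (fun z : T * T => K z.1 z.2).

Definition bform (u v : T -> R) : R :=
  \int[(P \x P)%E]_z (u z.1 * K z.1 z.2 * v z.2).

Lemma bmeas_bform (u v : T -> R) : bmeas u -> bmeas v ->
  bmeas (fun z : T * T => u z.1 * K z.1 z.2 * v z.2).
Proof.
by move=> bu bv; apply: bmeasM; [apply: bmeasM => //; exact: bmeas_left|exact: bmeas_right].
Qed.

Lemma bformC (u v : T -> R) : kernel_symmetric K -> bmeas u -> bmeas v ->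
  bform u v = bform v u.
Proof.
move=> sK bu bv; rewrite /bform int_prod; last exact: bmeas_bform.
rewrite int_prod2; last exact: bmeas_bform.
congr Rintegral; apply/funext => x; congr Rintegral; apply/funext => y /=.
by rewrite sK; ring.
Qed.

Lemma bform_suml n (c : nat -> R) (a : nat -> T -> R) v :
  (forall i, bmeas (a i)) -> bmeas v ->
  bform (fun x => \sum_(i < n) c i * a i x) v = \sum_(i < n) c i * bform (a i) v.
Proof.
move=> ba bv; rewrite /bform.
rewrite (_ : (fun z : T * T => _) =
    fun z => \sum_(i < n) c i * (a i z.1 * K z.1 z.2 * v z.2)); last first.
  apply/funext => z; rewrite !mulr_suml; apply: eq_bigr => i _; ring.
rewrite int_sum; last by move=> i; apply: bmeasM; [exact: bmeas_cst|exact: bmeas_bform].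
by apply: eq_bigr => i _; rewrite intZl//; exact: bmeas_bform.
Qed.

Lemma bform_quad n (c : nat -> R) (a : nat -> T -> R) : kernel_symmetric K ->
  (forall i, bmeas (a i)) ->
  quad n (fun i j => bform (a i) (a j)) c =
  bform (fun x => \sum_(i < n) c i * a i x) (fun x => \sum_(i < n) c i * a i x).
Proof.
move=> sK ba; have bs : bmeas (fun x => \sum_(i < n) c i * a i x).
  by apply: bmeas_sum => i; apply: bmeasM => //; exact: bmeas_cst.
rewrite bform_suml//; apply: eq_bigr => i _.
rewrite bformC// bform_suml// mulr_sumr; apply: eq_bigr => j _.
by rewrite [bform (a j) _]bformC// mulrA.
Qed.

Lemma bformB (u v u' v' : T -> R) : bmeas u -> bmeas v -> bmeas u' -> bmeas v' ->
  bform u v - bform u' v' =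
  bform (fun x => u x - u' x) v + bform u' (fun x => v x - v' x).
Proof.
move=> bu bv bu' bv'; rewrite /bform -intB; [|exact: bmeas_bform|exact: bmeas_bform].
rewrite -intD; [|exact: (bmeas_bform (bmeasB bu bu') bv)|exact: (bmeas_bform bu' (bmeasB bv bv'))].
by congr Rintegral; apply/funext => z; ring.
Qed.

End bilinear_forms.

Section tensor_products.
Context {R : realType} d1 d2 (T1 : measurableType d1) (T2 : measurableType d2).
Context (P : probability T1 R) (Q : probability T2 R).

Lemma int_prod_mul (u : T1 -> R) (v : T2 -> R) : bmeas u -> bmeas v ->
  \int[(P \x Q)%E]_z (u z.1 * v z.2) = \int[P]_x u x * \int[Q]_y v y.
Proof.
move=> bu bv; rewrite int_prod; last exact: bmeas_tensor.
rewrite -intZr//; congr Rintegral; apply/funext => x /=.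
by rewrite intZl.
Qed.

End tensor_products.

Lemma bform_le {R : realType} d (T : measurableType d) (P : probability T R)
    (K : T -> T -> R) (M : R) (u v : T -> R) :
  bmeas (fun z : T * T => K z.1 z.2) -> (forall x y, `|K x y| <= M) ->
  bmeas u -> bmeas v ->
  `|bform P K u v| <= M * (\int[P]_x `|u x| * \int[P]_x `|v x|).
Proof.
move=> bK KM bu bv; have bb := bmeas_bform bK bu bv.
have bu' := bmeas_norm bu; have bv' := bmeas_norm bv.
apply: le_trans (le_normr_Rintegral _ _) _ => //; first exact: bmeas_integrable.
rewrite -int_prod_mul// -intZl; last exact: (bmeas_tensor bu' bv').
apply: int_le; first exact: bmeas_norm.
  by apply: bmeasM; [exact: bmeas_cst|exact: (bmeas_tensor bu' bv')].
move=> z; rewrite !normrM (mulrC `|u z.1|) -mulrA.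
by rewrite ler_wpM2r// mulr_ge0.
Qed.

Section tensor_kernels.
Context {R : realType} d1 d2 (T1 : measurableType d1) (T2 : measurableType d2).
Context (P : probability T1 R) (Q : probability T2 R).
Context (K : T1 -> T1 -> R) (L : T2 -> T2 -> R).

Definition tensor (x y : T1 * T2) : R := K x.1 y.1 * L x.2 y.2.

Hypotheses (bK : bmeas (fun z : T1 * T1 => K z.1 z.2))
  (bL : bmeas (fun z : T2 * T2 => L z.1 z.2)).

Let measurable_swap2 : measurable_fun [set: (T1 * T2) * (T1 * T2)]
  (fun z => ((z.1.1, z.2.1), (z.1.2, z.2.2))).
Proof. by have [] := mpres_interchange P Q P Q. Qed.

Lemma bmeas_tensor_kernel : bmeas (fun z : (T1 * T2) * (T1 * T2) => tensor z.1 z.2).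
Proof.
exact: (bmeas_comp measurable_swap2 (bmeas_tensor bK bL)).
Qed.

Lemma int_tensor (G : T1 * T1 -> R) (H : T2 * T2 -> R) : bmeas G -> bmeas H ->
  \int[((P \x Q) \x (P \x Q))%E : probability ((T1 * T2) * (T1 * T2))%type R]_z
    (G (z.1.1, z.2.1) * H (z.1.2, z.2.2)) =
  \int[(P \x P)%E]_z G z * \int[(Q \x Q)%E]_z H z.
Proof.
move=> bG bH; rewrite -int_prod_mul//.
by rewrite (int_mpres (mpres_interchange P Q P Q))//; exact: bmeas_tensor.
Qed.

Lemma bform_tensor (a a' : T1 -> R) (b b' : T2 -> R) :
  bmeas a -> bmeas a' -> bmeas b -> bmeas b' ->
  bform (P \x Q)%E tensor (fun z => a z.1 * b z.2) (fun z => a' z.1 * b' z.2) =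
  bform P K a a' * bform Q L b b'.
Proof.
move=> ba ba' bb bb'; rewrite /bform -int_tensor; [|exact: bmeas_bform|exact: bmeas_bform].
by congr Rintegral; apply/funext => z; rewrite /tensor/=; ring.
Qed.

Lemma norm1_tensor : norm1 (P \x Q)%E tensor = norm1 P K * norm1 Q L.
Proof. exact: int_tensor. Qed.

Lemma deg_moment_tensor (a : T1 -> R) (b : T2 -> R) : bmeas a -> bmeas b ->
  deg_moment (P \x Q)%E tensor (fun z => a z.1 * b z.2) =
  deg_moment P K a * deg_moment Q L b.
Proof.
move=> ba bb; rewrite /deg_moment -int_tensor; last 2 first.
- by apply: bmeasM => //; exact: bmeas_left.
- by apply: bmeasM => //; exact: bmeas_left.
by congr Rintegral; apply/funext => z; rewrite /tensor/=; ring.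
Qed.

Lemma root_moment_tensor (F : sgraph) (u : F) (a : T1 -> R) (b : T2 -> R) :
  bmeas a -> bmeas b ->
  root_moment (P \x Q)%E tensor u (fun z => a z.1 * b z.2) =
  root_moment P K u a * root_moment Q L u b.
Proof.
move=> ba bb; rewrite /root_moment.
have bl : bmeas (fun x : #|F|.-tuple T1 => edge_prod K x * a (vpoint x u)).
  by apply: bmeasM; [exact: bmeas_edge_prod|exact: bmeas_vpoint].
have br : bmeas (fun x : #|F|.-tuple T2 => edge_prod L x * b (vpoint x u)).
  by apply: bmeasM; [exact: bmeas_edge_prod|exact: bmeas_vpoint].
rewrite -int_prod_mul// (int_mpres (mpres_unzip P Q #|F|)); last exact: (bmeas_tensor bl br).
congr Rintegral; apply/funext => x /=.
rewrite /edge_prod /vpoint /tensor big_split/= !tnth_map.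
under [in RHS]eq_bigr => e _ do rewrite !tnth_map.
under [X in _ = _ * (X * _)]eq_bigr => e _ do rewrite !tnth_map.
ring.
Qed.

(** The Schur product theorem for kernels. On a function of finite rank the form is the
    sum of the entrywise product of two positive semidefinite matrices, and such
    functions are dense for the L1 norm. *)
Lemma psd_tensor : kernel_symmetric K -> kernel_symmetric L ->
  kernel_psd P K -> kernel_psd Q L -> kernel_psd (P \x Q)%E tensor.
Proof.
move=> sK sL psK psL.
have sT : kernel_symmetric tensor by move=> x y; rewrite /tensor sK sL.
have bT := bmeas_tensor_kernel.
have rank_ge0 g : finite_rank g -> 0 <= bform (P \x Q)%E tensor g g.
  move=> [n [a [b [ba bb /funext ->]]]].
  pose ab i (z : T1 * T2) := a i z.1 * b i z.2.
  have bab i : bmeas (ab i) by exact: bmeas_tensor.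
  rewrite (_ : (fun z => _) = fun z => \sum_(i < n) 1 * ab i z); last first.
    by apply/funext => z; apply: eq_bigr => i _; rewrite mul1r.
  rewrite -(bform_quad _ bT n (fun=> 1) sT bab) /quad.
  rewrite (_ : (\sum_(i < n) _) =
    \sum_(i < n) \sum_(j < n) bform P K (a i) (a j) * bform Q L (b i) (b j)); last first.
    by apply: eq_bigr => i _; apply: eq_bigr => j _; rewrite !mul1r bform_tensor.
  apply: (@schur_sum_ge0 _ n (fun i j => bform P K (a i) (a j)) (fun i j => bform Q L (b i) (b j))).
  - by move=> i j; rewrite bformC.
  - by move=> i j; rewrite bformC.
  - move=> c; rewrite bform_quad//.
    have [ms bs] : bmeas (fun x => \sum_(i < n) c i * a i x).
      by apply: bmeas_sum => i; apply: bmeasM => //; exact: bmeas_cst.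
    exact: psK.
  - move=> c; rewrite bform_quad//.
    have [ms bs] : bmeas (fun x => \sum_(i < n) c i * b i x).
      by apply: bmeas_sum => i; apply: bmeasM => //; exact: bmeas_cst.
    exact: psL.
move=> f mf bdf; have bf : bmeas f by split.
rewrite -/(bform (P \x Q)%E tensor f f).
have [_ [M' TM']] := bT.
pose M := `|M'|.
have TM x y : `|tensor x y| <= M by exact: le_trans (TM' (x, y)) (ler_norm _).
pose I := \int[(P \x Q)%E]_z `|f z|.
have I0 : 0 <= I by exact: int_ge0.
pose C := M * (2 * I + 1).
have M0 : 0 <= M by exact: normr_ge0.
have C0 : 0 <= C by apply: mulr_ge0 => //; apply: addr_ge0 => //; exact: mulr_ge0.
suff key e : 0 < e -> e <= 1 -> - (C * e) <= bform (P \x Q)%E tensor f f.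
  rewrite -oppr_le0; apply/ler_addgt0Pr => r r0; rewrite add0r.
  pose e := Num.min 1 (r / (C + 1)).
  have C1 : 0 < C + 1 by rewrite ltr_wpDl.
  have e0 : 0 < e by rewrite lt_min ltr01 divr_gt0.
  have e1 : e <= 1 by rewrite ge_min lexx.
  have er : e * (C + 1) <= r by rewrite -ler_pdivlMr// ge_min lexx orbT.
  have := key e e0 e1; rewrite lerNl => h; apply: le_trans h _; nra.
move=> e0 e1; have [g rg ge] := L1_approx_bmeas P Q bf e0.
have bg := finite_rank_bmeas rg.
have bfg := bmeasB bf bg.
have Ig : \int[(P \x Q)%E]_z `|g z| <= I + 1.
  apply: (@le_trans _ _ (\int[(P \x Q)%E]_z (`|f z| + `|f z - g z|))).
    apply: int_le; [exact: bmeas_norm|by apply: bmeasD; exact: bmeas_norm|].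
    by move=> z; rewrite -[g z](subKr (f z)) (le_trans (ler_normB _ _))// subKr.
  rewrite intD; [|exact: bmeas_norm|exact: bmeas_norm].
  by rewrite lerD2l (le_trans ge).
have h := bformB (P \x Q)%E bT bf bf bg bg.
have h1 := bform_le (P \x Q)%E bT TM bfg bf.
have h2 := bform_le (P \x Q)%E bT TM bg bfg.
have h3 := rank_ge0 g rg.
have D0 : 0 <= \int[(P \x Q)%E]_z `|f z - g z| by exact: int_ge0.
have G0 : 0 <= \int[(P \x Q)%E]_z `|g z| by exact: int_ge0.
have b1 : M * (\int[(P \x Q)%E]_z `|f z - g z| * I) <= M * (e * I).
  by rewrite ler_wpM2l// ler_wpM2r.
have b2 : M * (\int[(P \x Q)%E]_z `|g z| * \int[(P \x Q)%E]_z `|f z - g z|) <= M * ((I + 1) * e).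
  by rewrite ler_wpM2l// ler_pM.
have {}h1 := le_trans h1 b1; have {}h2 := le_trans h2 b2.
move: h1 h2; rewrite !ler_norml => /andP[h1 _] /andP[h2 _].
suff arith (q qg x y : R) : q - qg = x + y -> 0 <= qg -> - (M * (e * I)) <= x ->
    - (M * ((I + 1) * e)) <= y -> - (C * e) <= q by exact: (arith _ _ _ _ h h3 h1 h2).
clear; rewrite /C => qE qg0 x0 y0; lra.
Qed.

Lemma bounded_dnn_tensor : bounded_dnn P K -> bounded_dnn Q L ->
  bounded_dnn (P \x Q)%E tensor.
Proof.
move=> [_ sK _ K0 psK] [_ sL _ L0 psL].
have [mT [M TM]] := bmeas_tensor_kernel; split => //.
- by move=> x y; rewrite /tensor sK sL.
- by exists M => x y; exact: (TM (x, y)).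
- by move=> x y; exact: mulr_ge0.
- exact: psd_tensor.
Qed.

End tensor_kernels.

(** * Vertex degrees and the equality case *)

Section degrees.
Variable F : sgraph.

Definition degree (u : F) : nat :=
  \sum_(e in edges F) ((e.1 == u) + (e.2 == u)).

Lemma sum_edges (R : nmodType) (g : F -> R) :
  \sum_(e in edges F) (g e.1 + g e.2) = \sum_(u : F) g u *+ degree u.
Proof.
under [RHS]eq_bigr => u _ do rewrite /degree -sumrMnr.
rewrite exchange_big/=; apply: eq_bigr => e _.
have pick v : g v = \sum_(u : F) g u *+ (v == u).
  rewrite (bigD1 v)//= eqxx mulr1n big1 ?addr0// => u uv.
  by rewrite eq_sym (negbTE uv).
rewrite [in LHS](pick e.1) [in LHS](pick e.2) -big_split/=.
by apply: eq_bigr => u _; rewrite mulrnDr.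
Qed.

Lemma edge_of (u v : F) : sedge u v ->
  exists2 e, e \in edges F & e = (u, v) \/ e = (v, u).
Proof.
move=> uv; have [lt|gt|/ord_inj/enum_rank_inj uv_eq] :=
    ltngtP (enum_rank u) (enum_rank v).
- by exists (u, v); [rewrite inE/= uv|left].
- by exists (v, u); [rewrite inE/= sedge_sym uv|right].
- by move: uv; rewrite uv_eq sedge_irrefl.
Qed.

Lemma degree_ge (u : F) (e : F * F) : e \in edges F ->
  ((e.1 == u) + (e.2 == u) <= degree u)%N.
Proof. by move=> eE; rewrite /degree (bigD1 e)//= leq_addr. Qed.

Lemma incident_edge (u : F) : exists e, (e \in edges F) && ((e.1 == u) || (e.2 == u)).
Proof.
have [v /edge_of[e eE uv]] := sedge_nonisolated u.
by exists e; rewrite eE; case: uv => ->; rewrite /= eqxx ?orbT.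
Qed.

Lemma degree_gt0 (u : F) : (0 < degree u)%N.
Proof.
have [e /andP[eE eu]] := incident_edge u.
by apply: leq_trans (degree_ge u eE); case/orP: eu => ->; rewrite ?addn1.
Qed.

Lemma degree1_uniq (u : F) (e e' : F * F) : degree u = 1%N ->
  e \in edges F -> e' \in edges F ->
  (e.1 == u) || (e.2 == u) -> (e'.1 == u) || (e'.2 == u) -> e = e'.
Proof.
move=> du eE e'E eu e'u; apply/eqP; apply: contraT => ee'.
have : (2 <= degree u)%N.
  rewrite /degree (bigD1 e)//= (bigD1 e')/=; last by rewrite e'E eq_sym.
  rewrite addnA; apply: leq_trans (leq_addr _ _).
  by case/orP: eu => ->; case/orP: e'u => ->; do ?case: (_ == _).
by rewrite du.
Qed.

Lemma edge_neq (e : F * F) : e \in edges F -> e.1 != e.2.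
Proof.
by rewrite inE => /andP[_]; apply: contraTneq => ->; rewrite ltnn.
Qed.

(** Every vertex lies on exactly one edge, so it is determined by this edge together
    with the end that it forms. *)
Lemma degree1_matching : (forall u : F, degree u = 1%N) -> is_matching F.
Proof.
move=> d1; pose eof u := xchoose (incident_edge u).
have eofP u : eof u \in edges F /\ (((eof u).1 == u) || ((eof u).2 == u)).
  by have /andP[] := xchooseP (incident_edge u).
have eofE u e : e \in edges F -> (e.1 == u) || (e.2 == u) -> eof u = e.
  by move=> eE eu; have [fE fu] := eofP u; exact: (degree1_uniq (d1 u) fE eE fu eu).
have [u0 [v0 /edge_of[e0 e0E _]]] := sedge_nonempty F.
pose h (u : F) : 'I_#|edges F| * bool := (enum_rank_in e0E (eof u), (eof u).2 == u).
pose g (z : 'I_#|edges F| * bool) : F :=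
  if z.2 then (enum_val z.1).2 else (enum_val z.1).1.
exists #|edges F|, h; split.
  exists g.
    move=> u; have [fE fu] := eofP u; rewrite /g /h/= enum_rankK_in//.
    by case: ((eof u).2 =P u) fu => [->//|_]; rewrite orbF => /eqP.
  move=> [i b]; have iE := enum_valP i; have ne := edge_neq iE.
  rewrite /h /g/=; case: b => /=.
    by rewrite (eofE _ _ iE) ?eqxx ?orbT// enum_valK_in.
  by rewrite (eofE _ _ iE) ?eqxx// enum_valK_in eq_sym (negbTE ne).
move=> u v; rewrite /mK2_edge /h/=; apply/idP/andP.
  move=> /edge_of[e eE uv]; have ne := edge_neq eE.
  have eu : eof u = e by apply: eofE => //; case: uv => ->; rewrite /= eqxx ?orbT.
  have ev : eof v = e by apply: eofE => //; case: uv => ->; rewrite /= eqxx ?orbT.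
  rewrite eu ev; split=> //; case: uv ne => -> /= ne; rewrite eqxx.
    by rewrite [v == u]eq_sym (negbTE ne).
  by rewrite [u == v]eq_sym (negbTE ne).
have [uE uu] := eofP u; have [vE vv] := eofP v.
move=> [/eqP/(congr1 enum_val)]; rewrite !enum_rankK_in// => euv.
move: vv; rewrite -euv; move: (eof u) uE uu => e.
rewrite inE => /andP[se _].
case: (e.2 =P u) => [<-|_]; case: (e.2 =P v) => [<-|_]; rewrite ?orbT ?orbF//.
  by move=> _ /eqP <- _; rewrite sedge_sym.
by move=> /eqP <- _ _.
Qed.

Lemma exists_degree_ge2 : ~ is_matching F -> exists u : F, (2 <= degree u)%N.
Proof.
move=> nm; apply: contrapT => nd; apply: nm; apply: degree1_matching => u.
apply/eqP; rewrite eqn_leq degree_gt0 andbT leqNgt; apply/negP => du.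
by apply: nd; exists u.
Qed.

End degrees.

Section moments.
Context {R : realType} d (T : measurableType d) (P : probability T R).
Variables (F : sgraph) (K : T -> T -> R).
Hypothesis bK : bmeas (fun z : T * T => K z.1 z.2).

Lemma root_momentZ (u : F) c a : bmeas a ->
  root_moment P K u (fun x => c * a x) = c * root_moment P K u a.
Proof.
move=> ba; rewrite /root_moment -intZl; last first.
  by apply: bmeasM; [exact: bmeas_edge_prod|exact: bmeas_vpoint].
by congr Rintegral; apply/funext => x; rewrite mulrCA.
Qed.

Lemma deg_momentZ c a : bmeas a ->
  deg_moment P K (fun x => c * a x) = c * deg_moment P K a.
Proof.
move=> ba; rewrite /deg_moment -intZl; last by apply: bmeasM => //; exact: bmeas_left.
by congr Rintegral; apply/funext => x; rewrite mulrCA.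
Qed.

End moments.

Lemma bounded_dnn_bmeas {R : realType} d (T : measurableType d) (P : probability T R)
  (K : T -> T -> R) : bounded_dnn P K -> bmeas (fun z : T * T => K z.1 z.2).
Proof. by move=> [mK _ [M KM] _ _]; split=> //; exists M => z. Qed.

Section equality_case.
Context {R : realType} (F : sgraph) (good_F : sidorenko_good R F).
Context d (T : measurableType d) (P : probability T R) (K : T -> T -> R).
Hypotheses (stdP : standard P) (atP : atomless P) (dnnK : bounded_dnn P K).
Hypotheses (p_gt0 : 0 < norm1 P K)
  (tight : hom_density P F K = norm1 P K ^+ edge_count F).

Let bK := bounded_dnn_bmeas dnnK.
Let p := norm1 P K.
Let t := hom_density P F K.
Let KK := tensor K K.
Let PP : probability (T * T)%type R := (P \x P)%E.

Let hom_tensor : hom_density PP F KK = t * t.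
Proof.
have b1 : bmeas (fun _ : T => 1 : R) by exact: bmeas_cst.
have [u _] := sedge_nonempty F.
have := root_moment_tensor P P bK bK u b1 b1; rewrite /root_moment.
under eq_fun do rewrite !mulr1.
by under [in X in _ = X -> _]eq_fun do rewrite !mulr1.
Qed.

Let t_gt0 : 0 < t. Proof. by rewrite /t tight exprn_gt0. Qed.

(** The first-order condition for the tensor square of [K] at product functions, whose
    moments are squares of moments of [K]. *)
Let first_order_tensor (a b : T -> R) (c : R) : bmeas a -> bmeas b ->
  \int[P]_x a x = 0 ->
  p * p * (\sum_(e in edges F) c * (root_moment P K e.1 b * root_moment P K e.1 b +
      root_moment P K e.2 b * root_moment P K e.2 b) +
     \sum_(u : F) root_moment P K u a * root_moment P K u a) =
  t * t * (2 * (deg_moment P K a * deg_moment P K a +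
      c * (deg_moment P K b * deg_moment P K b))) *+ edge_count F.
Proof.
move=> ba bb Ia0.
have stdPP : standard PP by exact: standard_prod.
have atPP : atomless PP by exact: atomless_prod.
have dnnKK : bounded_dnn PP KK by exact: bounded_dnn_tensor.
have nKK : norm1 PP KK = p * p by exact: norm1_tensor.
have gKK : 0 < norm1 PP KK by rewrite nKK mulr_gt0.
have tKK : hom_density PP F KK = norm1 PP KK ^+ edge_count F.
  by rewrite hom_tensor nKK exprMn /t tight.
have bcb : bmeas (fun x => c * b x) by apply: bmeasM => //; exact: bmeas_cst.
have baa := bmeas_tensor ba ba; have bbb := bmeas_tensor bcb bb.
have Iaa : \int[PP]_z (a z.1 * a z.2) = 0 by rewrite int_prod_mul// Ia0 mul0r.
have := first_order good_F stdPP atPP dnnKK gKK tKK baa bbb Iaa.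
rewrite nKK hom_tensor (deg_moment_tensor P P bK bK ba ba).
rewrite (deg_moment_tensor P P bK bK bcb bb) deg_momentZ// -[c * _ * _]mulrA => <-.
congr (_ * (_ + _)).
  apply: eq_bigr => e _; rewrite !(root_moment_tensor P P bK bK _ bcb bb).
  by rewrite !root_momentZ// -!mulrA -mulrDr.
by apply: eq_bigr => u _; rewrite (root_moment_tensor P P bK bK u ba ba).
Qed.

(** Over all ends of edges, the average of the numbers [p * root_moment P K u b] is
    [t * deg_moment P K b] by the first-order condition for [K], and the average of
    their squares is the square of this by the condition for the tensor square. So
    their variance is zero. *)
Let root_moment_eq (b : T -> R) (u : F) : bmeas b ->
  p * root_moment P K u b = t * deg_moment P K b.
Proof.
move=> bb; have b0 : bmeas (fun _ : T => 0 : R) by exact: bmeas_cst.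
have I0 : \int[P]_x (0 : R) = 0 by exact: int_cst.
have T0 v : root_moment P K v (fun _ => 0) = 0.
  by have := root_momentZ P bK v 0 b0; rewrite !mul0r.
have D0 : deg_moment P K (fun _ => 0) = 0.
  by have := deg_momentZ P bK 0 b0; rewrite !mul0r.
set dl := deg_moment P K b; set n := edge_count F.
have e1 : p * \sum_(e in edges F) (root_moment P K e.1 b + root_moment P K e.2 b) =
    t * (2 * dl) *+ n.
  have := first_order good_F stdP atP dnnK p_gt0 tight b0 bb I0.
  by rewrite D0 add0r [X in _ + X]big1 ?addr0.
have e2 : p * p * \sum_(e in edges F) (root_moment P K e.1 b * root_moment P K e.1 b +
      root_moment P K e.2 b * root_moment P K e.2 b) = t * t * (2 * (dl * dl)) *+ n.
  have := first_order_tensor 1 b0 bb I0.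
  rewrite D0 mul0r mul1r add0r [X in _ + X]big1 ?addr0; last by move=> v _; rewrite T0 mul0r.
  by under eq_bigr do rewrite mul1r.
pose tau (v : F) := p * root_moment P K v b - t * dl.
have : \sum_(e in edges F) (tau e.1 ^+ 2 + tau e.2 ^+ 2) = 0.
  transitivity (\sum_(e in edges F) (p * p * (root_moment P K e.1 b * root_moment P K e.1 b +
      root_moment P K e.2 b * root_moment P K e.2 b) -
      2 * (t * dl) * (p * (root_moment P K e.1 b + root_moment P K e.2 b)) + 2 * (t * dl) ^+ 2)).
    by apply: eq_bigr => e _; rewrite /tau; ring.
  rewrite !big_split/= sumrN -!mulr_sumr e1 e2 sumr_const -/n.
  suff cancel (x y : R) : x * x * (2 * (y * y)) *+ n - 2 * (x * y) * (x * (2 * y) *+ n) +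
      2 * (x * y * (x * (y *+ n))) = 0 by exact: cancel.
  rewrite !mulrnAr -mulrnBl -mulrnDl (_ : _ + _ = 0) ?mul0rn//.
  by clear; ring.
rewrite (sum_edges (fun v => tau v ^+ 2)) => /psumr_eq0P h.
have /eqP : tau u ^+ 2 *+ degree u = 0.
  by apply: h => // v _; rewrite mulrn_wge0// sqr_ge0.
rewrite mulrn_eq0 -leqn0 leqNgt degree_gt0/= expf_eq0/= subr_eq0.
by move=> /eqP.
Qed.

(** Reweighting the tensor square by [1 + e a(x) a(y)] and rescaling it by
    [1 - e a(x) a(y)] leaves the norm unchanged to first order, while a vertex [u]
    contributes [(1 - degree u)] times the square of its moment to the density. All
    these terms have the same sign, so they vanish; at a vertex of degree at least 2
    the moment itself does. *)
Let deg_moment_eq0 (a : T -> R) : ~ is_matching F -> bmeas a ->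
  \int[P]_x a x = 0 -> deg_moment P K a = 0.
Proof.
move=> /exists_degree_ge2[u du] ba Ia0.
have := first_order_tensor (- 1) ba ba Ia0.
rewrite mulN1r subrr !mulr0 mul0rn => /eqP.
rewrite !mulf_eq0 !(gt_eqF p_gt0)/= -mulr_sumr mulN1r.
rewrite (sum_edges (fun v => root_moment P K v a * root_moment P K v a)) addrC.
rewrite subr_eq0 eq_sym -subr_eq0 -sumrB => /eqP/psumr_eq0P h.
have : root_moment P K u a * root_moment P K u a *+ degree u -
    root_moment P K u a * root_moment P K u a = 0.
  apply: h => // v _; rewrite subr_ge0 -[leLHS]mulr1n ler_wpMn2l ?degree_gt0//.
  by rewrite -expr2 sqr_ge0.
move=> /eqP; rewrite -[X in _ - X]mulr1n -mulrnBr ?degree_gt0// mulrn_eq0.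
rewrite subn_eq0 leqNgt du/= mulf_eq0 orbb => /eqP T0.
have := root_moment_eq u ba; rewrite T0 mulr0 => /esym/eqP.
by rewrite mulf_eq0 (gt_eqF t_gt0)/= => /eqP.
Qed.

Hypothesis not_matching_F : ~ is_matching F.

Lemma tight_deg_moment (a : T -> R) : bmeas a -> deg_moment P K a = p * \int[P]_x a x.
Proof.
move=> ba; set c := \int[P]_x a x.
have bc : bmeas (fun _ : T => c) by exact: bmeas_cst.
have Iac : \int[P]_x (a x - c) = 0 by rewrite intB// int_cst subrr.
have := deg_moment_eq0 not_matching_F (bmeasB ba bc) Iac.
have -> : deg_moment P K (fun x => a x - c) = deg_moment P K a - p * c.
  rewrite /p /norm1 -intZr// /deg_moment -intB.
  - by congr Rintegral; apply/funext => z; rewrite mulrBr.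
  - by apply: bmeasM => //; exact: bmeas_left.
  - by apply: bmeasM => //; exact: bmeas_cst.
by move=> /eqP; rewrite subr_eq0 => /eqP.
Qed.

Lemma tight_regular : kernel_regular P p K.
Proof.
apply: ae_eq_test; [exact: (bmeas_int P bK)|exact: bmeas_cst|] => h bh.
by rewrite -deg_momentE// tight_deg_moment// intZr// mulrC.
Qed.

(** Since [K] has constant degree, [K - p] annihilates constants and therefore
    only sees the part of [f] of mean zero, where it agrees with [K]. *)
Lemma tight_psd : kernel_psd P (fun x y => K x y - p).
Proof.
move=> f mf bdf; have bf : bmeas f by split.
have [_ sK _ _ psK] := dnnK.
set c := \int[P]_x f x; pose g x := f x - c.
have bc : bmeas (fun _ : T => c) by exact: bmeas_cst.
have bg : bmeas g by exact: bmeasB.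
have [mg bdg] := bg.
have := psK _ mg bdg; congr (0 <= _).
have bKf : bmeas (fun z : T * T => K z.1 z.2 * f z.1).
  by apply: bmeasM => //; exact: bmeas_left.
have bKf2 : bmeas (fun z : T * T => K z.1 z.2 * f z.2).
  by apply: bmeasM => //; exact: bmeas_right.
have bfKf := bmeas_bform bK bf bf.
have bff := bmeas_tensor bf bf.
transitivity (\int[PP]_z (f z.1 * K z.1 z.2 * f z.2 - c * (K z.1 z.2 * f z.1 + K z.1 z.2 * f z.2)
    + c ^+ 2 * K z.1 z.2)).
  by congr Rintegral; apply/funext => z; rewrite /g; ring.
have bcs : bmeas (fun z : T * T => c * (K z.1 z.2 * f z.1 + K z.1 z.2 * f z.2)).
  by apply: bmeasM; [exact: bmeas_cst|exact: bmeasD].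
have bcK : bmeas (fun z : T * T => c ^+ 2 * K z.1 z.2).
  by apply: bmeasM => //; exact: bmeas_cst.
rewrite intD//; last exact: bmeasB.
rewrite intB// !intZl//; last exact: bmeasD.
rewrite intD// deg_momentC// -/(deg_moment P K f) tight_deg_moment// -/c -/(norm1 P K) -/p.
transitivity (\int[PP]_z (f z.1 * K z.1 z.2 * f z.2 - p * (f z.1 * f z.2))); last first.
  by congr Rintegral; apply/funext => z; ring.
rewrite intB//; last by apply: bmeasM => //; exact: bmeas_cst.
rewrite intZl// int_prod_mul// -/c; ring.
Qed.

End equality_case.

(** * Local density and positive semidefiniteness *)

Section local_density.
Context {R : realType} d (T : measurableType d) (P : probability T R).
Variables (U : T -> T -> R) (M : R).
Hypotheses (bU : bmeas (fun z : T * T => U z.1 z.2)) (UM : forall x y, `|U x y| <= M).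
Hypothesis dense_U : forall S, measurable S -> 0 <= bform P U \1_S \1_S.

Section cells.
Context (I : finType) (B : I -> set T).
Hypotheses (mB : forall i, measurable (B i))
  (tB : forall i j x, B i x -> B j x -> i = j).

Lemma sum_indicF (c : I -> R) k x : B k x -> \sum_i c i * \1_(B i) x = c k.
Proof.
move=> Bk; rewrite (bigD1 k)//= indicE mem_set// mulr1 big1 ?addr0// => i ik.
by rewrite indicE memNset ?mulr0// => /tB/(_ Bk) ik'; rewrite ik' eqxx in ik.
Qed.

Let bB i : bmeas (\1_(B i) : T -> R). Proof. exact: bmeas_indic. Qed.

Let beta i j := bform P U \1_(B i) \1_(B j).

Let bcB (c : I -> R) : bmeas (fun x => \sum_i c i * \1_(B i) x).
Proof. by apply: bmeas_sum => i; apply: bmeasM => //; exact: bmeas_cst. Qed.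

Lemma bform_cells (c : I -> R) :
  bform P U (fun x => \sum_i c i * \1_(B i) x) (fun x => \sum_i c i * \1_(B i) x) =
  \sum_i \sum_j c i * c j * beta i j.
Proof.
have bij i j : bmeas (fun z : T * T => \1_(B i) z.1 * U z.1 z.2 * \1_(B j) z.2).
  exact: bmeas_bform.
have bcij i j : bmeas (fun z : T * T => c i * c j * (\1_(B i) z.1 * U z.1 z.2 * \1_(B j) z.2)).
  by apply: bmeasM => //; exact: bmeas_cst.
transitivity (\int[(P \x P)%E]_z \sum_i \sum_j
    c i * c j * (\1_(B i) z.1 * U z.1 z.2 * \1_(B j) z.2)).
  congr Rintegral; apply/funext => z; rewrite !mulr_suml; apply: eq_bigr => i _.
  by rewrite mulr_sumr; apply: eq_bigr => j _; ring.
rewrite int_sum; last by move=> i; exact: bmeas_sum.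
apply: eq_bigr => i _; rewrite int_sum//; apply: eq_bigr => j _.
by rewrite intZl.
Qed.

(** The expectation of the form at a random union of cells, the cell [B i] being
    included with probability [c i], independently. *)
Definition random_form (c : I -> R) : R :=
  \sum_i \sum_j (if i == j then c i else c i * c j) * beta i j.

Let upd (c : I -> R) k (t : R) (i : I) : R := if i == k then t else c i.

(** This expectation is affine in each [c i] and nonnegative at the vertices of
    the cube. *)
Lemma random_form_ge0 (c : I -> R) : (forall i, 0 <= c i <= 1) -> 0 <= random_form c.
Proof.
suff key (s : seq I) : forall c, (forall i, 0 <= c i <= 1) ->
    (forall i, i \notin s -> c i = 0 \/ c i = 1) -> 0 <= random_form c.
  by move=> c01; apply: (key (enum I)) => // i; rewrite mem_enum.
elim: s => [|k s IH] {}c c01 cs.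
  have c2 i : c i * c i = c i by have [//|->|->] := cs i; rewrite ?mul0r ?mul1r.
  have -> : random_form c = \sum_i \sum_j c i * c j * beta i j.
    apply: eq_bigr => i _; apply: eq_bigr => j _.
    by case: eqP => // ->; rewrite c2.
  rewrite -bform_cells.
  pose S := \bigcup_(i in [set i | c i = 1]) B i.
  have mS : measurable S by apply: fin_bigcup_measurable => //; exact: finite_finset.
  rewrite (_ : (fun x => _) = \1_S); first exact: dense_U.
  apply/funext => x; have [[i _ Bi]|nB] := pselect ((\bigcup_i B i) x).
    rewrite (sum_indicF c Bi) indicE; have [//|ci|ci] := cs i.
      rewrite ci memNset// => -[j /= cj /tB/(_ Bi) ji].
      by move: cj; rewrite ji ci => /esym/eqP; rewrite oner_eq0.
    by rewrite ci mem_set//; exists i.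
  rewrite big1 ?indicE; last first.
    by move=> i _; rewrite indicE memNset ?mulr0// => Bi; apply: nB; exists i.
  by rewrite memNset// => -[i _ Bi]; apply: nB; exists i.
pose t := c k; have /andP[t0 t1] := c01 k.
have -> : random_form c = (1 - t) * random_form (upd c k 0) + t * random_form (upd c k 1).
  rewrite /random_form !mulr_sumr -big_split/=; apply: eq_bigr => i _.
  rewrite !mulr_sumr -big_split/=; apply: eq_bigr => j _.
  rewrite /upd; have [->|ij] := eqVneq i j.
    by have [->|jk] := eqVneq j k; rewrite /t; ring.
  have [ik|ik] := eqVneq i k; have [jk|jk] := eqVneq j k; rewrite ?ik ?jk /t; try ring.
  by rewrite ik jk eqxx in ij.
have upd01 r : 0 <= r <= 1 -> forall i, 0 <= upd c k r i <= 1.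
  by move=> r01 i; rewrite /upd; case: ifP.
have upds r : r = 0 \/ r = 1 -> forall i, i \notin s -> upd c k r i = 0 \/ upd c k r i = 1.
  move=> r01 i is_; rewrite /upd; case: ifPn => // ik; apply: cs.
  by rewrite in_cons negb_or ik.
apply: addr_ge0; apply: mulr_ge0; rewrite ?subr_ge0//.
  by apply: IH; [apply: upd01; rewrite lexx ler01|apply: upds; left].
by apply: IH; [apply: upd01; rewrite lexx ler01|apply: upds; right].
Qed.

(** The form at a step function differs from the expectation of [random_form] in the
    diagonal terms only, and these are small when the cells are. *)
Lemma bform_cells_ge (c : I -> R) (e : R) : 0 <= M -> 0 <= e ->
  (forall i, 0 <= c i <= 1) -> (forall i, fine (P (B i)) <= e) ->
  - (M * e) <= bform P U (fun x => \sum_i c i * \1_(B i) x) (fun x => \sum_i c i * \1_(B i) x).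
Proof.
move=> M0 e0 c01 Be; have G0 := random_form_ge0 c01.
rewrite bform_cells.
have fB0 i : 0 <= fine (P (B i)) by rewrite fine_ge0.
have beta_le i : `|beta i i| <= M * (e * fine (P (B i))).
  apply: le_trans (bform_le P bU UM (bB i) (bB i)) _; rewrite ler_wpM2l//.
  rewrite (_ : (fun x => `|\1_(B i) x|) = \1_(B i)); last first.
    by apply/funext => x; rewrite ger0_norm.
  by rewrite int_indic// ler_wpM2r.
have sumB : \sum_i fine (P (B i)) <= 1.
  rewrite -[leRHS](int_cst P).
  rewrite (_ : \sum_i fine (P (B i)) = \int[P]_x \sum_i 1 * \1_(B i) x); last first.
    rewrite int_sum; last by move=> i; apply: bmeasM => //; exact: bmeas_cst.
    by apply: eq_bigr => i _; rewrite intZl// int_indic// mul1r.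
  apply: int_le; [exact: (bcB (fun=> 1))|exact: bmeas_cst|move=> x].
  have [[i Bi]|nB] := pselect (exists i, B i x); first by rewrite (sum_indicF (fun=> 1) Bi).
  rewrite big1// => i _; rewrite indicE memNset ?mulr0// => Bi; apply: nB; by exists i.
have -> : \sum_i \sum_j c i * c j * beta i j = random_form c - \sum_i (c i - c i ^+ 2) * beta i i.
  rewrite /random_form -sumrB; apply: eq_bigr => i _.
  rewrite (bigD1 i)//= [in RHS](bigD1 i)//= eqxx.
  have -> : \sum_(j | j != i) (if i == j then c i else c i * c j) * beta i j =
      \sum_(j | j != i) c i * c j * beta i j.
    by apply: eq_bigr => j ji; rewrite eq_sym (negbTE ji).
  set S := \sum_(j | j != i) _; move: S (beta i i) (c i) => S x y; ring.
have : \sum_i (c i - c i ^+ 2) * beta i i <= M * e.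
  apply: (@le_trans _ _ (\sum_i M * (e * fine (P (B i))))).
    apply: ler_sum => i _; apply: le_trans (beta_le i).
    apply: le_trans (ler_norm _) _; rewrite normrM -[leRHS]mul1r ler_wpM2r//.
    have /andP[c0 c1] := c01 i.
    by rewrite ler_norml expr2; apply/andP; split; nra.
  by rewrite -!mulr_sumr ler_wpM2l// -[leRHS]mulr1 ler_wpM2l.
by move=> h; rewrite -[leLHS]add0r lerB.
Qed.

End cells.

Hypothesis small_cells : forall e : R, 0 < e -> exists (N : nat) (A : nat -> set T),
  [/\ forall k, measurable (A k), trivIset [set: nat] A,
      forall x, exists2 k, (k < N)%N & A k x & forall k, fine (P (A k)) <= e].

(** Cut the level sets of [f] into small cells. *)
Lemma dense_bform_ge0_01 (f : T -> R) : measurable_fun [set: T] f ->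
  (forall x, 0 <= f x <= 1) -> 0 <= bform P U f f.
Proof.
move=> mf f01.
have f1 x : `|f x| <= 1 by rewrite ger0_norm; have /andP[] := f01 x.
have bf : bmeas f by split=> //; exists 1.
have M0 : 0 <= M by exact: le_trans (UM point point).
suff key e : 0 < e -> - (3 * M * e) <= bform P U f f.
  rewrite -oppr_le0; apply/ler_addgt0Pr => r r0; rewrite add0r lerNl.
  have M1 : 0 < 3 * M + 1 by rewrite ltr_wpDl// mulr_ge0.
  have e0 : 0 < r / (3 * M + 1) by rewrite divr_gt0.
  apply: le_trans (key _ e0); rewrite lerN2.
  rewrite -[leRHS](@divfK _ (3 * M + 1)) ?gt_eqF// mulrC ler_wpM2l ?lerDl//.
  exact: ltW.
move=> e0.
have [N1 [A [mA tA cA Ae]]] := bmeas_step mf f01 e0.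
have [N2 [A' [mA' tA' cA' A'e]]] := small_cells e0.
pose B (i : 'I_N1 * 'I_N2) := A i.1 `&` A' i.2.
have mB i : measurable (B i) by exact: measurableI.
have tB i j x : B i x -> B j x -> i = j.
  move: i j => [i1 i2] [j1 j2] [/= a1 a2] [/= b1 b2]; congr pair; apply/val_inj.
    by apply: (tA i1 j1) => //; exists x.
  by apply: (tA' i2 j2) => //; exists x.
(* The cap at 1 only concerns empty cells. *)
pose c (i : 'I_N1 * 'I_N2) : R := Num.min 1 (i.1%:R * e).
have c01 i : 0 <= c i <= 1.
  rewrite /c; apply/andP; split; last by rewrite ge_min lexx.
  by rewrite le_min ler01 mulr_ge0// ltW.
pose g x := \sum_i c i * \1_(B i) x.
have bg : bmeas g.
  by apply: bmeas_sum => i; apply: bmeasM; [exact: bmeas_cst|exact: bmeas_indic].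
have gx x : exists2 i, g x = c i & B i x.
  have [k kN Ak] := cA x; have [l lN Al] := cA' x.
  have Bkl : B (Ordinal kN, Ordinal lN) x by split.
  by exists (Ordinal kN, Ordinal lN) => //; rewrite /g (sum_indicF tB c Bkl).
have g1 x : `|g x| <= 1.
  have [i -> _] := gx x; have /andP[h0 h1] := c01 i.
  by rewrite ger0_norm.
have fg x : `|f x - g x| <= e.
  have [i -> [Ai _]] := gx x; have /andP[h1 h2] := Ae _ _ Ai.
  have /andP[f0 fle1] := f01 x; rewrite !add0r in h1 h2.
  rewrite /c min_r; last by exact: le_trans fle1.
  by rewrite ger0_norm ?subr_ge0// lerBlDl; move: h2; rewrite -natr1; lra.
have PBe i : fine (P (B i)) <= e.
  apply: le_trans (A'e i.2); rewrite fine_le ?fin_num_measure//.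
  by apply: le_measure; rewrite ?inE//; exact: subIsetr.
have h3 := bform_cells_ge mB tB M0 (ltW e0) c01 PBe.
rewrite -/g in h3.
have bfg := bmeasB bf bg.
have h := bformB P bU bf bf bg bg.
have If1 : \int[P]_x `|f x| <= 1.
  rewrite -[leRHS](int_cst P); apply: int_le => //; [exact: bmeas_norm|exact: bmeas_cst].
have Ig1 : \int[P]_x `|g x| <= 1.
  rewrite -[leRHS](int_cst P); apply: int_le => //; [exact: bmeas_norm|exact: bmeas_cst].
have Ifg : \int[P]_x `|f x - g x| <= e.
  rewrite -[leRHS](int_cst P); apply: int_le => //; [exact: bmeas_norm|exact: bmeas_cst].
have i0 (u : T -> R) : 0 <= \int[P]_x `|u x| by exact: int_ge0.
have h1 : `|bform P U (fun x => f x - g x) f| <= M * e.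
  apply: le_trans (bform_le P bU UM bfg bf) _; rewrite ler_wpM2l// -[leRHS]mulr1.
  exact: ler_pM.
have h2 : `|bform P U g (fun x => f x - g x)| <= M * e.
  apply: le_trans (bform_le P bU UM bg bfg) _; rewrite ler_wpM2l// -[leRHS]mul1r.
  exact: ler_pM.
suff arith (q qg x y : R) : q - qg = x + y -> - (M * e) <= qg -> `|x| <= M * e ->
    `|y| <= M * e -> - (3 * M * e) <= q by exact: (arith _ _ _ _ h h3 h1 h2).
clear; move=> qE qg0; rewrite !ler_norml => /andP[x0 _] /andP[y0 _]; lra.
Qed.

Hypothesis null_U : forall h, bmeas h -> deg_moment P U h = 0.
Hypothesis sym_U : kernel_symmetric U.

(** The form does not change when a constant is added to [f], so nonnegativity on
    functions with values in [0,1] extends to all bounded functions. *)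
Lemma dense_psd : kernel_psd P U.
Proof.
move=> f mf bdf; have bf : bmeas f by split.
have [C' fC'] := bdf; pose C := `|C'| + 1.
have C0 : 0 < C by rewrite ltr_wpDl.
have fC x : `|f x| <= C by rewrite (le_trans (fC' x))// (le_trans (ler_norm _))// lerDl.
pose h x := (f x + C) / (2 * C).
have bC : bmeas (fun _ : T => C) by exact: bmeas_cst.
have bh : bmeas h by apply: bmeasM; [exact: bmeasD|exact: bmeas_cst].
have C20 : 0 < 2 * C by rewrite mulr_gt0.
have h01 x : 0 <= h x <= 1.
  have := fC x; rewrite ler_norml => /andP[h1 h2].
  by rewrite /h ler_pdivrMr// mul1r divr_ge0 ?(ltW C20)//=; lra.
have [mh _] := bh; have := dense_bform_ge0_01 mh h01.
have -> : \int[(P \x P)%E]_z (f z.1 * U z.1 z.2 * f z.2) = (2 * C) ^+ 2 * bform P U h h.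
  have bhh := bmeas_bform bU bh bh.
  have bUh : bmeas (fun z : T * T => U z.1 z.2 * h z.1) by apply: bmeasM => //; exact: bmeas_left.
  have bUh2 : bmeas (fun z : T * T => U z.1 z.2 * h z.2) by apply: bmeasM => //; exact: bmeas_right.
  have bU1 : bmeas (fun z : T * T => U z.1 z.2 * 1) by apply: bmeasM => //; exact: bmeas_cst.
  have bhl := bmeas_left bh; have bhr := bmeas_right bh.
  transitivity (\int[(P \x P)%E]_z ((2 * C) ^+ 2 * (h z.1 * U z.1 z.2 * h z.2)
     - (2 * C ^+ 2) * (U z.1 z.2 * h z.1 + U z.1 z.2 * h z.2) + C ^+ 2 * (U z.1 z.2 * 1))).
    congr Rintegral; apply/funext => z; rewrite /h; field.
    by rewrite gt_eqF.
  rewrite intD; last by apply: bmeasM => //; exact: bmeas_cst.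
    rewrite intB; last by apply: bmeasM; [exact: bmeas_cst|exact: bmeasD].
      rewrite !intZl//; last exact: bmeasD.
      rewrite intD// deg_momentC// -/(deg_moment P U h) null_U//.
      rewrite (_ : \int[_]_z (U z.1 z.2 * 1) = 0).
        by rewrite addr0 !mulr0 subr0 addr0.
      by rewrite -[LHS]/(deg_moment P U (fun=> 1)) null_U//; exact: bmeas_cst.
    by apply: bmeasM => //; exact: bmeas_cst.
  apply: bmeasB; first by apply: bmeasM => //; exact: bmeas_cst.
  by apply: bmeasM; [exact: bmeas_cst|exact: bmeasD].
by move=> h0; rewrite mulr_ge0// sqr_ge0.
Qed.

End local_density.

(** * The quantile transform *)

Lemma ae_imply {R : realType} d (T : measurableType d) (P : probability T R)
    (A C : T -> Prop) : {ae P, forall x, A x} -> (forall x, A x -> C x) ->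
  {ae P, forall x, C x}.
Proof. by move=> aeA AC; apply: filterS aeA. Qed.

Lemma ae_imply2 {R : realType} d (T : measurableType d) (P : probability T R)
    (A B C : T -> Prop) : {ae P, forall x, A x} -> {ae P, forall x, B x} ->
  (forall x, A x -> B x -> C x) -> {ae P, forall x, C x}.
Proof. by move=> aeA aeB ABC; apply: filterS2 aeA aeB => x; exact: ABC. Qed.

Lemma prob_bigcup_le {R : realType} d (T : measurableType d) (P : probability T R)
    (F : (set T)^nat) (u : R) :
  (forall n, measurable (F n)) -> (forall m n, (m <= n)%N -> F m `<=` F n) ->
  (forall n, fine (P (F n)) <= u) -> fine (P (\bigcup_n F n)) <= u.
Proof.
move=> mF ndF Fu; have mU : measurable (\bigcup_n F n) by exact: bigcupT_measurable.
have ndF' : nondecreasing_seq F by move=> m n mn; apply/subsetPset; exact: ndF.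
have := nondecreasing_cvg_mu (mu := P) mF mU ndF'.
rewrite -[X in _ --> X]fineK ?fin_num_measure// => /fine_cvgP[_] cv.
by apply: (cvgr_to_le cv); near=> n; exact: Fu.
Unshelve. all: by end_near. Qed.

Lemma prob_eq_rays {R : realType} (Q1 Q2 : probability (measurableTypeR R) R) :
  (forall x : R, Q1 `]x, +oo[%classic = Q2 `]x, +oo[%classic) ->
  forall A, measurable A -> Q1 A = Q2 A.
Proof.
move=> Q12 A mA; apply: (@measure_unique _ _ (measurableTypeR R) (@RGenOInfty.G R)
  (fun n => `](- n%:R), +oo[%classic)) => //.
- exact: RGenOInfty.measurableE.
- move=> _ _ [x ->] [y ->]; exists (Num.max x y).
  by apply/seteqP; split=> z /=; rewrite !in_itv/= !andbT gt_max; [move=> [-> ->]|move=> /andP].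
- by move=> n; exists (- n%:R).
- apply/seteqP; split=> // x _; exists (Num.truncn (- x)).+1 => //=.
  by rewrite in_itv/= andbT ltrNl truncnS_gt.
- by move=> _ [x ->]; exact: Q12.
- by move=> k; rewrite ltey_eq fin_num_measure.
Qed.

Section quantile_transform.
Context {R : realType} d (T : measurableType d) (P : probability T R).
Variables (f : T -> R).
Hypotheses (mf : measurable_fun [set: T] f)
  (f0 : forall r, P (f @^-1` [set r]) = 0%E).

Let ray r := f @^-1` `]-oo, r].
Let mray r : measurable (ray r).
Proof. by apply: preimage_measurable => //; exact: measurable_itv. Qed.
Let up r := f @^-1` `]r, +oo[.
Let mup r : measurable (up r).
Proof. by apply: preimage_measurable => //; exact: measurable_itv. Qed.

Definition distr_fun (r : R) : R := fine (P (ray r)).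

Let upE r : fine (P (up r)) = 1 - distr_fun r.
Proof.
rewrite (_ : up r = ~` ray r); last first.
  apply/seteqP; split=> x; rewrite /up /ray /= !in_itv/= andbT ltNge; first by move/negP.
  by move=> /negP.
rewrite probability_setC//= /distr_fun -[X in (_ - X)%E]fineK ?fin_num_measure//.
Qed.

Let distr_fun_le r s : r <= s -> distr_fun r <= distr_fun s.
Proof.
move=> rs; rewrite fine_le ?fin_num_measure//; apply: le_measure; rewrite ?inE//.
by move=> x; rewrite /ray/= !in_itv/= => /le_trans; apply.
Qed.

Let inv_le m n : (m <= n)%N -> n.+1%:R^-1 <= m.+1%:R^-1 :> R.
Proof. by move=> mn; rewrite lef_pV2 ?posrE// ler_nat. Qed.

Let distr_fun_right u r : (forall n, u <= distr_fun (r + n.+1%:R^-1)) -> u <= distr_fun r.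
Proof.
move=> h; suff : fine (P (up r)) <= 1 - u by rewrite upE; lra.
rewrite (_ : up r = \bigcup_n up (r + n.+1%:R^-1)).
  apply: prob_bigcup_le => // [m n mn x|n]; last by rewrite upE lerB.
  rewrite /up/= !in_itv/= !andbT; apply: le_lt_trans.
  by rewrite lerD2l inv_le.
apply/seteqP; split=> x; rewrite /up/= !in_itv/= !andbT.
  by move=> /ltr_add_invr[k rk]; exists k => //=; rewrite in_itv/= andbT.
by move=> [k _ /=]; rewrite in_itv/= andbT; apply: lt_trans; rewrite ltrDl.
Qed.

Let distr_fun_left u r : (forall n, distr_fun (r - n.+1%:R^-1) <= u) -> distr_fun r <= u.
Proof.
move=> h.
have m1 : measurable (f @^-1` [set r]) by exact: preimage_measurable.
have m2 : measurable (\bigcup_n ray (r - n.+1%:R^-1)) by exact: bigcupT_measurable.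
rewrite /distr_fun (_ : ray r = (f @^-1` [set r]) `|` \bigcup_n ray (r - n.+1%:R^-1)).
  rewrite setUC measureU0//; last exact: f0.
  apply: prob_bigcup_le => // m n mn x.
  rewrite /ray/= !in_itv/= => /le_trans; apply.
  by rewrite lerD2l lerN2 inv_le.
apply/seteqP; split=> x; rewrite /ray/= in_itv/=.
  rewrite le_eqVlt => /orP[/eqP->|]; [by left|right].
  have [k rk] := ltr_add_invr b; exists k => //=.
  by rewrite in_itv/= lerBrDr ltW.
move=> [->//|[k _ /=]]; rewrite in_itv/= => /le_trans; apply.
by rewrite gerBl.
Qed.

Let distr_fun_high u : u < 1 -> exists r, u <= distr_fun r.
Proof.
move=> u1; apply: contrapT => h.
have : fine (P (\bigcup_n ray n%:R)) <= u.
  apply: prob_bigcup_le => // [m n mn x|n].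
    by rewrite /ray/= !in_itv/= => /le_trans; apply; rewrite ler_nat.
  by rewrite leNgt; apply/negP => un; apply: h; exists n%:R; exact: ltW.
rewrite (_ : \bigcup_n ray n%:R = setT) ?probability_setT/= ?leNgt ?u1//.
apply/seteqP; split=> // x _; exists (Num.truncn (f x)).+1 => //=.
by rewrite /ray/= in_itv/= ltW// truncnS_gt.
Qed.

Let distr_fun_low u : 0 < u -> exists r, distr_fun r < u.
Proof.
move=> u0; apply: contrapT => h.
have : fine (P (\bigcup_n up (- n%:R))) <= 1 - u.
  apply: prob_bigcup_le => // [m n mn x|n].
    by rewrite /up/= !in_itv/= !andbT; apply: le_lt_trans; rewrite lerN2 ler_nat.
  rewrite upE lerB// leNgt; apply/negP => un; apply: h; by exists (- n%:R).
rewrite (_ : \bigcup_n up (- n%:R) = setT) ?probability_setT/=; first lra.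
apply/seteqP; split=> // x _; exists (Num.truncn (- f x)).+1 => //=.
by rewrite /up/= in_itv/= andbT ltrNl truncnS_gt.
Qed.

Definition quantile (u : R) : R := inf [set r | u <= distr_fun r].

Let quantile_inf u : 0 < u < 1 -> has_inf [set r | u <= distr_fun r].
Proof.
move=> /andP[u0 u1]; split; first by have [r ur] := distr_fun_high u1; exists r.
have [r ru] := distr_fun_low u0; exists r => s /= us.
by rewrite leNgt; apply/negP => /ltW/distr_fun_le; rewrite leNgt (lt_le_trans ru).
Qed.

Lemma quantile_le u r : 0 < u < 1 -> (quantile u <= r) = (u <= distr_fun r).
Proof.
move=> u01; have hi := quantile_inf u01; apply/idP/idP; last first.
  by move=> ur; apply: ge_inf => //; case: hi.
move=> qr; apply: distr_fun_right => n.
have [|s us sq] := @inf_adherent _ _ n.+1%:R^-1 _ hi; first by rewrite invr_gt0.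
apply: le_trans us (distr_fun_le _); apply: ltW; apply: lt_le_trans sq _.
by rewrite lerD2r.
Qed.

(** Without point masses the distribution function is continuous and cannot jump
    over [u]. *)
Lemma distr_funK u : 0 < u < 1 -> distr_fun (quantile u) = u.
Proof.
move=> u01; apply/eqP; rewrite eq_le -quantile_le// lexx andbT.
apply: distr_fun_left => n; rewrite leNgt; apply/negP => /ltW.
by rewrite -quantile_le// leNgt gtrBl invr_gt0 ltr0n.
Qed.

(** Outside the open unit interval the quantile function is replaced by its
    value at 1/2, which keeps it measurable on the whole line. *)
Definition clamp (u : R) : R := if (0 < u) && (u < 1) then u else 1 / 2.

Lemma clamp01 u : 0 < clamp u < 1.
Proof. by rewrite /clamp; case: ifP => // _; apply/andP; split; lra. Qed.

Lemma measurable_clamp : measurable_fun [set: R] clamp.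
Proof.
apply: measurable_fun_ifT; [|exact: measurable_id|exact: measurable_cst].
apply: measurable_and; apply: measurable_fun_ltr; try exact: measurable_cst;
  exact: measurable_id.
Qed.

Lemma measurable_quantile : measurable_fun [set: R] (quantile \o clamp).
Proof.
move=> mT; apply: (measurability _ (RGenOInfty.measurableE R)) => //.
move=> _ [_ [x ->] <-]; rewrite setTI.
rewrite (_ : _ @^-1` _ = clamp @^-1` `]distr_fun x, +oo[%classic).
  by apply: (preimage_measurable measurable_clamp); exact: measurable_itv.
by apply/seteqP; split=> u; rewrite /= !in_itv/= !andbT !ltNge quantile_le// clamp01.
Qed.

Lemma lambda01_oo : lambda01 R `]0, 1[%classic = 1%E.
Proof.
rewrite /lambda01/= /mrestr setIidl; last first.
  by move=> y /=; rewrite !in_itv/= => /andP[h1 h2]; rewrite !ltW.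
by rewrite lebesgue_measure_itv/= lte_fin ltr01 sube0.
Qed.

Lemma lambda01_itv : {ae lambda01 R, forall u, 0 < u < 1}.
Proof.
have m01 : measurable (`]0, 1[%classic : set (measurableTypeR R)) := measurable_itv _.
exists (~` `]0, 1[%classic); split.
- exact: measurableC.
- by rewrite probability_setC// [X in (_ - X)%E]lambda01_oo subee.
- by move=> u /= h; rewrite in_itv.
Qed.

Lemma mpres_quantile (Q : probability (measurableTypeR R) R) :
  mpres P Q f -> mpres (lambda01 R) Q (quantile \o clamp).
Proof.
move=> [_ fQ]; have [Q' [_ qQ']] := @mpres_exists R _ _ (measurableTypeR R)
  (measurableTypeR R) (lambda01 R) _ measurable_quantile.
split=> [|A mA]; first exact: measurable_quantile.
rewrite qQ'//; move: A mA; apply: prob_eq_rays => x.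
have mx : measurable (`]x, +oo[%classic : set (measurableTypeR R)) by exact: measurable_itv.
rewrite -qQ'// -fQ//; transitivity ((1 - distr_fun x)%:E); last first.
  by rewrite -upE fineK// fin_num_measure//; exact: mup.
have c01 : 0 <= distr_fun x <= 1.
  by rewrite fine_ge0//= -lee_fin fineK ?fin_num_measure// probability_le1.
have /andP[c0 c1] := c01.
rewrite (_ : _ @^-1` _ = clamp @^-1` `]distr_fun x, +oo[%classic); last first.
  by apply/seteqP; split=> u; rewrite /= !in_itv/= !andbT !ltNge quantile_le// clamp01.
have mc : measurable (clamp @^-1` `]distr_fun x, +oo[%classic : set (measurableTypeR R)).
  by apply: (preimage_measurable measurable_clamp); exact: measurable_itv.
have m01 : measurable (`]0, 1[%classic : set (measurableTypeR R)) by exact: measurable_itv.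
rewrite -(prob_setI1 m01 mc lambda01_oo).
rewrite (_ : _ `&` _ = `]distr_fun x, 1[%classic); last first.
  apply/seteqP; split=> u; rewrite /= !in_itv/= ?andbT.
    by move=> [/andP[u0 u1]]; rewrite /clamp u0 u1/= => ->.
  move=> /andP[cu u1]; have u0 := le_lt_trans c0 cu.
  by rewrite /clamp u0 u1.
transitivity (@lebesgue_measure R (`]distr_fun x, 1[%classic `&` `[0, 1]%classic)) => //.
rewrite setIidl; last first.
  move=> y /=; rewrite !in_itv/= => /andP[h1 h2].
  by rewrite (ltW h2) (le_trans c0 (ltW h1)).
rewrite lebesgue_measure_itv/= lte_fin -EFinB.
by case: ltP => // h; congr EFin; apply/eqP; rewrite eq_sym subr_eq0 eq_le c1 h.
Qed.

End quantile_transform.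

(** [phi] is the quantile function of the law of a coordinate of the space, followed by
    the inverse of the coordinate; [psi] is the coordinate followed by the distribution
    function. *)
Lemma lambda01_transport {R : realType} d (T : measurableType d) (P : probability T R) :
  standard P -> atomless P ->
  exists (phi : measurableTypeR R -> T) (psi : T -> R),
    [/\ mpres (lambda01 R) P phi, measurable_fun [set: T] psi &
        {ae lambda01 R, forall u, psi (phi u) = u}].
Proof.
move=> /standardP[f [g [X [mf mg mX PX gf]]]] atP.
have f0 := atomless_diffuse atP mf mX PX gf.
have [Q PQ] := @mpres_exists R _ _ _ (measurableTypeR R) P f mf.
have qQ := mpres_quantile mf PQ.
have gP : mpres Q P g.
  split=> // A mA.
  have mgA : measurable (g @^-1` A : set (measurableTypeR R)) by exact: preimage_measurable.
  have [_ <-//] := PQ; rewrite -(prob_setI1 mX mA PX).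
  have mfgA : measurable (f @^-1` (g @^-1` A)) by exact: (preimage_measurable mf).
  rewrite -(prob_setI1 mX mfgA PX); congr (P _).
  by apply/seteqP; split=> x /= [Xx]; rewrite gf.
exists (g \o (quantile P f \o @clamp R)), (distr_fun P f \o f); split.
- exact: mpres_comp qQ gP.
- apply: (measurableT_comp _ mf).
  apply: (@nondecreasing_measurable R setT) => // r s rs.
  rewrite /distr_fun fine_le ?fin_num_measure//.
  + by apply: (preimage_measurable mf); exact: measurable_itv.
  + by apply: (preimage_measurable mf); exact: measurable_itv.
  apply: le_measure; rewrite ?inE.
  + by apply: (preimage_measurable mf); exact: measurable_itv.
  + by apply: (preimage_measurable mf); exact: measurable_itv.
  by move=> x /=; rewrite !in_itv/= => /le_trans; apply.
have fgQ : {ae Q, forall y, f (g y) = y}.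
  have mfg : measurable_fun [set: R] (fun y => f (g y) == y).
    by apply: measurable_fun_eqr; [exact: measurableT_comp|exact: measurable_id].
  have mN : measurable ((fun y => f (g y) == y) @^-1` [set false] : set (measurableTypeR R)).
    by rewrite -[X in measurable X]setTI; exact: mfg.
  exists ((fun y => f (g y) == y) @^-1` [set false]); split=> //.
  + have [_ <-//] := PQ.
    have mfN := @preimage_measurable _ _ _ (measurableTypeR R) f _ mf mN.
    rewrite -(prob_setI1 mX mfN PX) (_ : _ `&` _ = set0) ?measure0//.
    by apply/seteqP; split=> x //= [Xx]; rewrite gf// eqxx.
  + by move=> y /= /eqP/negbTE.
apply: (ae_imply2 (P := lambda01 R) lambda01_itv (mpres_ae qQ fgQ)) => u u01 fgu /=.
have -> : clamp u = u by rewrite /clamp u01.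
rewrite -[RHS](distr_funK mf f0 u01); congr distr_fun.
by move: fgu; rewrite /= /clamp u01.
Qed.

(** * Locally dense regular graphons and forcing *)

Lemma dense_bform {R : realType} d (T : measurableType d) (P : probability T R)
    (W : T -> T -> R) (rho : R) (S : set T) :
  bmeas (fun z : T * T => W z.1 z.2) -> measurable S ->
  bform P (fun x y => W x y - rho) \1_S \1_S =
  \int[(P \x P)%E]_(z in S `*` S) W z.1 z.2 - rho * fine (P S) ^+ 2.
Proof.
move=> bW mS; have bS := @bmeas_indic R _ _ _ mS.
have bWS := bmeas_bform bW bS bS; have bSS := bmeas_tensor bS bS.
rewrite Rintegral_mkcond [in RHS](_ : _ \_ _ = fun z => \1_S z.1 * W z.1 z.2 * \1_S z.2).
  rewrite -(int_indic _ mS) expr2 -int_prod_mul// -intZl// -intB//.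
    by congr Rintegral; apply/funext => z; ring.
  by apply: bmeasM => //; exact: bmeas_cst.
apply/funext => -[x y]; rewrite patchE !indicE/=.
case: ifPn => [|nS].
  by rewrite inE => -[/= Sx Sy]; rewrite !mem_set// mulr1 mul1r.
have [Sx|Sx] := boolP (x \in S); last by rewrite !mul0r.
have [Sy|Sy] := boolP (y \in S); last by rewrite mulr0.
by move: nS; rewrite mem_set//; split; exact: set_mem.
Qed.

Section unit_interval.
Context {R : realType}.

Lemma lambda01_small_cells (e : R) : 0 < e ->
  exists (N : nat) (A : nat -> set (measurableTypeR R)),
  [/\ forall k, measurable (A k), trivIset [set: nat] A,
      forall x, exists2 k, (k < N)%N & A k x &
      forall k, fine (lambda01 R (A k)) <= e].
Proof.
move=> e0; pose tr (x : measurableTypeR R) : R := Num.max 0 (Num.min x 1).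
have mtr : measurable_fun [set: measurableTypeR R] tr.
  apply: measurable_maxr; first exact: measurable_cst.
  by apply: measurable_minr; [exact: measurable_id|exact: measurable_cst].
have tr01 x : 0 <= tr x <= 1 by rewrite /tr le_max lexx/= ge_max ler01 ge_min lexx orbT.
have [N [A [mA tA cA Ae]]] := bmeas_step mtr tr01 e0.
exists N, A; split=> // k.
pose J : set (measurableTypeR R) := `[k%:R * e, k.+1%:R * e]%classic.
pose I01 : set (measurableTypeR R) := `[0, 1]%classic.
have mJ : measurable J by exact: measurable_itv.
have mI : measurable I01 by exact: measurable_itv.
have key : (lambda01 R (A k) <= e%:E)%E.
  apply: (@le_trans _ _ (@lebesgue_measure R J)).
    change ((@lebesgue_measure R (A k `&` I01) <= @lebesgue_measure R J)%E).
    apply: le_measure; rewrite ?inE//; first exact: measurableI.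
    move=> x [/Ae/andP[h1 h2]]; rewrite /I01 /J /= !in_itv/= => /andP[x0 x1].
    have trx : tr x = x by rewrite /tr min_l// max_r.
    by rewrite trx !add0r in h1 h2; rewrite h1 ltW.
  rewrite lebesgue_measure_itv/=; case: ifP => _; last by rewrite lee_fin ltW.
  by rewrite -EFinB lee_fin -natr1; lra.
by rewrite -lee_fin fineK// fin_num_measure.
Qed.

Section dense_regular_graphon.
Variables (rho : R) (W : measurableTypeR R -> measurableTypeR R -> R).
Hypotheses (rho0 : 0 <= rho) (graphonW : graphon W)
  (denseW : locally_dense (lambda01 R) rho W)
  (regularW : kernel_regular (lambda01 R) rho W).

Let bW : bmeas (fun z : measurableTypeR R * measurableTypeR R => W z.1 z.2).
Proof.
have [mW _ W01] := graphonW; split=> //; exists 1 => z.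
by have /andP[h0 h1] := W01 z.1 z.2; rewrite ger0_norm.
Qed.

Lemma norm1_regular : norm1 (lambda01 R) W = rho.
Proof.
rewrite /norm1 int_prod// -[RHS](int_cst (lambda01 R)); apply: int_ae.
- exact: (bmeas_int (lambda01 R) bW).
- exact: bmeas_cst.
- exact: regularW.
Qed.

(** Regularity makes [W - rho] annihilate constants, so local density makes it positive
    semidefinite; the constant kernel [rho] is positive semidefinite as well. *)
Lemma dense_regular_dnn : bounded_dnn (lambda01 R) W.
Proof.
have [mW sW W01] := graphonW.
pose U x y := W x y - rho.
have bU : bmeas (fun z : measurableTypeR R * measurableTypeR R => U z.1 z.2).
  by apply: bmeasB => //; exact: bmeas_cst.
have UM x y : `|U x y| <= 1 + rho.
  have /andP[h0 h1] := W01 x y.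
  by have r0 := rho0; rewrite /U ler_norml; apply/andP; split; lra.
have psdU : kernel_psd (lambda01 R) U.
  apply: (dense_psd bU UM).
  - by move=> S mS; rewrite dense_bform// subr_ge0; exact: denseW.
  - exact: lambda01_small_cells.
  - move=> h bh; rewrite deg_momentE// -[RHS](int_cst (lambda01 R)).
    apply: int_ae; [apply: bmeasM => //; exact: (bmeas_int (lambda01 R) bU)|exact: bmeas_cst|].
    apply: (ae_imply (P := lambda01 R) regularW) => x Wx.
    have -> : \int[lambda01 R]_y U x y = 0; last by rewrite mulr0.
    rewrite /U intB; [|exact: (bmeas_section x bW)|exact: bmeas_cst].
    by rewrite Wx int_cst subrr.
  - by move=> x y; rewrite /U sW.
split => //.
- by exists 1 => x y; have /andP[h0 h1] := W01 x y; rewrite ger0_norm.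
- by move=> x y; have /andP[] := W01 x y.
move=> f mf bdf; have bf : bmeas f by split.
have bff := bmeas_tensor bf bf; have bUf := bmeas_bform bU bf bf.
rewrite (_ : \int[_]_z _ = bform (lambda01 R) U f f +
    rho * \int[(lambda01 R \x lambda01 R)%E]_z (f z.1 * f z.2)); last first.
  rewrite /bform -intZl// -intD//; last by apply: bmeasM => //; exact: bmeas_cst.
  by congr Rintegral; apply/funext => z; rewrite /U; ring.
rewrite int_prod_mul// addr_ge0//; first exact: psdU.
by rewrite mulr_ge0// -expr2 sqr_ge0.
Qed.

End dense_regular_graphon.
End unit_interval.

Lemma good_regular_KNRS (R : realType) (F : sgraph) :
  sidorenko_good R F -> regular_KNRS R F.
Proof.
move=> good_F rho W /andP[rho0 _] gW dW rW.
have := good_F _ _ _ _ (@standard_lambda01 R) (@atomless_lambda01 R)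
  (dense_regular_dnn rho0 gW dW rW).
by rewrite (norm1_regular gW rW).
Qed.

Section transport.
Context {R : realType} d1 d2 (T1 : measurableType d1) (T2 : measurableType d2).
Context (P1 : probability T1 R) (P2 : probability T2 R) (phi : T1 -> T2).
Hypothesis mphi : mpres P1 P2 phi.

Lemma hom_density_mpres (F : sgraph) (K : T2 -> T2 -> R) (c : R) :
  bmeas (fun z : T2 * T2 => K z.1 z.2) ->
  hom_density P1 F (fun x y => c * K (phi x) (phi y)) =
  c ^+ edge_count F * hom_density P2 F K.
Proof.
move=> bK; have bE : bmeas (@edge_prod R _ T2 F K) by exact: bmeas_edge_prod.
rewrite /hom_density -intZl// (int_mpres (mpres_power #|F| mphi)); last first.
  by apply: bmeasM => //; exact: bmeas_cst.
congr Rintegral; apply/funext => x; rewrite big_split/= prodr_const; congr (_ * _).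
by apply: eq_bigr => e _; rewrite !tnth_map.
Qed.

Lemma ae_constant_mpres (K : T2 -> T2 -> R) (p : R) : kernel_measurable K ->
  ae_constant P1 p (fun x y => K (phi x) (phi y)) -> ae_constant P2 p K.
Proof.
move=> mK [N [mN N0 KN]].
pose B := (fun z : T2 * T2 => K z.1 z.2 == p) @^-1` [set false].
have mB : measurable B.
  have me : measurable_fun [set: T2 * T2] (fun z => K z.1 z.2 == p).
    exact: (measurable_fun_eqr mK (measurable_cst p)).
  by rewrite /B -[X in measurable X]setTI; exact: me.
exists B; split=> //; last by move=> z /= /eqP/negbTE.
have [_ <-//] := mpres_prod mphi mphi.
apply/eqP; rewrite eq_le measure_ge0 andbT -N0; apply: le_measure; rewrite ?inE//.
  by apply: preimage_measurable mB; have [] := mpres_prod mphi mphi.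
by move=> z Bz; apply: KN => /= /eqP; move: Bz; rewrite /B/= => ->.
Qed.

Lemma kernel_regular_mpres (K : T2 -> T2 -> R) (p c : R) :
  bmeas (fun z : T2 * T2 => K z.1 z.2) -> kernel_regular P2 p K ->
  kernel_regular P1 (c * p) (fun x y => c * K (phi x) (phi y)).
Proof.
move=> bK rK; have rK' := mpres_ae mphi rK.
apply: (ae_imply rK') => x /= <-.
have bKx : bmeas (fun y => K (phi x) y) by exact: (bmeas_section (phi x) bK).
by rewrite intZl ?(int_mpres mphi bKx)//; apply: bmeas_comp bKx; case: mphi.
Qed.

End transport.

Lemma bform_ae {R : realType} d (T : measurableType d) (P : probability T R)
    (U : T -> T -> R) (u v : T -> R) :
  bmeas (fun z : T * T => U z.1 z.2) -> bmeas u -> bmeas v ->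
  {ae P, forall x, u x = v x} -> bform P U u u = bform P U v v.
Proof.
move=> bU bu bv uv.
have bUx x : bmeas (fun y => U x y) by exact: (bmeas_section x bU).
have bformE w : bmeas w -> bform P U w w = \int[P]_x (w x * \int[P]_y (U x y * w y)).
  move=> bw; rewrite /bform int_prod; last exact: bmeas_bform.
  congr Rintegral; apply/funext => x /=; rewrite -intZl; last exact: bmeasM.
  by congr Rintegral; apply/funext => y; rewrite mulrA.
have bin w : bmeas w -> bmeas (fun x => \int[P]_y (U x y * w y)).
  by move=> bw; exact: (bmeas_int P (bmeasM bU (bmeas_right bw))).
rewrite !bformE//.
apply: int_ae; [exact: (bmeasM bu (bin _ bu))|exact: (bmeasM bv (bin _ bv))|].
apply: (ae_imply uv) => x ->; congr (_ * _).
apply: int_ae; [exact: bmeasM|exact: bmeasM|].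
by apply: (ae_imply uv) => y ->.
Qed.

(** The indicator of [S] agrees almost everywhere with the pullback along [phi] of its
    composite with [psi], on which the semidefiniteness of [K - p] can be tested. *)
Lemma psd_transport {R : realType} d (T : measurableType d) (P : probability T R)
    (K : T -> T -> R) (p c : R) (phi : measurableTypeR R -> T) (psi : T -> R) :
  mpres (lambda01 R) P phi -> measurable_fun [set: T] psi ->
  {ae lambda01 R, forall u, psi (phi u) = u} ->
  bmeas (fun z : T * T => K z.1 z.2) -> 0 <= c ->
  kernel_psd P (fun x y => K x y - p) ->
  locally_dense (lambda01 R) (c * p) (fun x y => c * K (phi x) (phi y)).
Proof.
move=> mphi mpsi psiK bK c0 psK S mS.
have [mp _] := mphi.
pose f x : R := \1_S (psi x).
have bS : bmeas (\1_S : measurableTypeR R -> R) by exact: bmeas_indic.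
have bf : bmeas f by exact: (bmeas_comp (T' := measurableTypeR R) mpsi bS).
have bfp : bmeas (fun u => f (phi u)) by exact: bmeas_comp.
have mpp : measurable_fun [set: measurableTypeR R * measurableTypeR R]
    (fun z => (phi z.1, phi z.2)) by have [] := mpres_prod mphi mphi.
have bKp := bmeas_comp mpp bK.
have bU : bmeas (fun z : T * T => K z.1 z.2 - p) by apply: bmeasB => //; exact: bmeas_cst.
have bcK : bmeas (fun z : measurableTypeR R * measurableTypeR R => c * K (phi z.1) (phi z.2)).
  by apply: bmeasM => //; exact: bmeas_cst.
have bcU : bmeas (fun z : measurableTypeR R * measurableTypeR R =>
    c * K (phi z.1) (phi z.2) - c * p).
  by apply: bmeasB => //; exact: bmeas_cst.
pose W (x y : measurableTypeR R) : R := c * K (phi x) (phi y).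
rewrite -subr_ge0 -[X in 0 <= X](@dense_bform R _ _ (lambda01 R) W (c * p) S bcK mS).
have fE : {ae lambda01 R, forall u, f (phi u) = \1_S u}.
  by apply: (ae_imply (P := lambda01 R) psiK) => u psiu; rewrite /f psiu.
rewrite -(@bform_ae _ _ _ (lambda01 R) (fun x y => W x y - c * p) _ _ bcU bfp bS fE).
rewrite (_ : bform _ _ _ _ = c * bform P (fun x y => K x y - p) f f).
  by rewrite mulr_ge0//; have [mf bdf] := bf; exact: psK.
have bb := bmeas_bform (K := fun x y => K x y - p) bU bf bf.
rewrite /bform (int_mpres (mpres_prod mphi mphi) bb) -intZl; last exact: (bmeas_comp mpp bb).
by congr Rintegral; apply/funext => z /=; rewrite /W /f; ring.
Qed.

Theorem theorem7p6 (R : realType) (F : sgraph)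
    (good_F : sidorenko_good R F) (not_matching_F : ~ is_matching F) :
  (forall (d : measure_display) (T : measurableType d) (P : probability T R)
      (K : T -> T -> R),
    standard P -> atomless P -> bounded_dnn P K -> 0 < norm1 P K ->
    hom_density P F K = norm1 P K ^+ edge_count F ->
    kernel_regular P (norm1 P K) K /\
    kernel_psd P (fun x y => K x y - norm1 P K)) /\
  regular_KNRS R F /\
  (sidorenko_good_forcing R F <-> regular_KNRS_forcing R F).
Proof.
split; [|split; [exact: good_regular_KNRS|split]].
- move=> d T P K stdP atP dnnK p0 tight; split.
    exact: (tight_regular good_F stdP atP dnnK p0 tight not_matching_F).
  exact: (tight_psd good_F stdP atP dnnK p0 tight not_matching_F).
- move=> [_ forcing]; split; first exact: good_regular_KNRS.
  move=> rho W /andP[rho0 _] gW dW rW tight.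
  have dnnW := dense_regular_dnn (ltW rho0) gW dW rW.
  have nW := norm1_regular gW rW.
  have := forcing _ _ _ _ (@standard_lambda01 R) (@atomless_lambda01 R) dnnW.
  by rewrite nW; apply.
move=> [_ forcing]; split=> // d T P K stdP atP dnnK p0 tight.
set p := norm1 P K in p0 tight *.
have regK := tight_regular good_F stdP atP dnnK p0 tight not_matching_F.
have psdK := tight_psd good_F stdP atP dnnK p0 tight not_matching_F.
have bK := bounded_dnn_bmeas dnnK.
have [mK sK [M KM] K0 _] := dnnK.
have [phi [psi [mphi mpsi psiK]]] := lambda01_transport stdP atP.
have M0 : 0 <= M by exact: le_trans (KM point point).
(* The scaling must bring [K] into [0,1] and its mean [p] strictly below 1. *)
pose c := (M + p + 1)^-1.
have D0 : 0 < M + p + 1 by lra.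
have c0 : 0 < c by rewrite invr_gt0.
have cp : 0 < c * p < 1.
  by rewrite mulr_gt0//= /c mulrC ltr_pdivrMr// mul1r; lra.
pose W u v := c * K (phi u) (phi v).
have gW : graphon W.
  have [mp _] := mphi; split.
  - have mpp : measurable_fun [set: measurableTypeR R * measurableTypeR R]
      (fun z => (phi z.1, phi z.2)) by have [] := mpres_prod mphi mphi.
    have [] // : bmeas (fun z => W z.1 z.2).
    by apply: bmeasM; [exact: bmeas_cst|exact: (bmeas_comp mpp bK)].
  - by move=> u v; rewrite /W sK.
  - move=> u v; rewrite /W mulr_ge0//=; last exact: ltW.
    rewrite /c mulrC ler_pdivrMr// mul1r.
    have := le_trans (ler_norm _) (KM (phi u) (phi v)); lra.
have dW : locally_dense (lambda01 R) (c * p) W.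
  exact: psd_transport mphi mpsi psiK bK (ltW c0) psdK.
have rW : kernel_regular (lambda01 R) (c * p) W by exact: (kernel_regular_mpres mphi c bK regK).
have tW : hom_density (lambda01 R) F W = (c * p) ^+ edge_count F.
  by rewrite /W (hom_density_mpres mphi F c bK) tight exprMn.
have cW := forcing _ _ cp gW dW rW tW.
apply: (ae_constant_mpres mphi mK).
apply: (ae_imply (P := (lambda01 R \x lambda01 R)%E) cW) => z Wz.
by apply: (mulfI (lt0r_neq0 c0)); exact: Wz.
Qed.
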